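(* Let $F=\mathbb{Q}_2$. Then $F$ has seven distinct quadratic extensions $K$, namely $\mathbb{Q}_2(\sqrt{c})$ for $c\in\{-3,-6,2,-1,-2,3,6\}$. The distinct isomorphism classes of nonassociative quaternion algebras with left nucleus $K$ are represented (each exactly once) by $(K/F,\sigma,a)$ where $\sigma\in\mathrm{Gal}(K/F)$ is the nontrivial element and $a\in\mathcal{S}(K)$, where $\mathcal{S}(K)$ is given as follows: (a) If $K=\mathbb{Q}_2(\sqrt{-3})$, then this extension is unramified and $$\mathcal{S}(K)=\{\sqrt{-3},\ 2\sqrt{-3},\ 1+s\sqrt{-3},\ 2+s\sqrt{-3}\mid s\in\mathbb{Q}_2^\times/\{\pm1\}\}.$$ (b) If $K=\mathbb{Q}_2(\sqrt{\alpha})$ with $\alpha\in\{2,-6\}$, then this extension is ramified and $-1\in N_{K/F}(K^\times)$, and $$\mathcal{S}(K)=\{\sqrt{\alpha},\ 3\sqrt{\alpha},\ 1+s\sqrt{\alpha},\ 3+s\sqrt{\alpha}\mid s\in\mathbb{Q}_2^\times/\{\pm1\}\}.$$ (c) If $K=\mathbb{Q}_2(\sqrt{\alpha})$ with $\alpha\in\{-1,-2,3,6\}$, then this extension is ramified and $-1\notin N_{K/F}(K^\times)$, and $$\mathcal{S}(K)=\{\sqrt{\alpha},\ \pm1+s\sqrt{\alpha}\mid s\in\mathbb{Q}_2^\times/\{\pm1\}\}.$$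
   Context: For a quadratic Galois extension $K/F$ with nontrivial automorphism $\sigma$ and $a\in K\smallsetminus F$, the (proper) nonassociative quaternion algebra $(K/F,\sigma,a)$ is the unital $4$-dimensional $F$-algebra $K\oplus Kt$ with $F$-bilinear multiplication determined by $(k)(k')=kk'$, $(k)(k't)=kk't$, $(kt)(k')=k\sigma(k')t$, $(kt)(k't)=k\sigma(k')a$ for $k,k'\in K$. The left nucleus of an algebra $A$ is $\{x\in A:(xy)z=x(yz)\ \forall y,z\in A\}$; for $(K/F,\sigma,a)$ with $a\in K\smallsetminus F$ it equals $K$. Isomorphism means isomorphism of $F$-algebras. $N_{K/F}$ is the field norm. $\mathbb{Q}_2^\times/\{\pm1\}$ stands for a set of representatives in $\mathbb{Q}_2^\times$ of the cosets of $\{\pm1\}$. *)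

(* Defs.v *)
From HB Require Import structures.
From mathcomp Require Import all_boot all_order all_algebra all_fingroup all_field.
From mathcomp Require Import boolp classical_sets.
Set Implicit Arguments.
Unset Strict Implicit.
Unset Printing Implicit Defensive.
Import Order.TTheory GRing.Theory Num.Theory.
Local Open Scope ring_scope.

(** The ring of 2-adic integers, as the inverse limit of the rings Z/2^n: the
    n-th coordinate is the canonical representative in [0, 2^n[. *)

Record Z2 := MkZ2 {
  Z2_val :> nat -> int;
  Z2_coherent : forall n, Z2_val n = (Z2_val n.+1 %% 2%:Z ^+ n)%Z }.

HB.instance Definition _ := gen_eqMixin Z2.
HB.instance Definition _ := gen_choiceMixin Z2.

Section Z2Theory.
Implicit Types (x y z : Z2) (g : nat -> int) (n : nat).

Lemma modz_dvdm (a d e : int) : (d %| e)%Z -> ((a %% e)%Z = a %[mod d])%Z.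
Proof.
by case/dvdzP=> k ->; rewrite [in RHS](divz_eq a (k * d)) mulrA modzMDl.
Qed.

Lemma Z2P x y : (forall n, x n = y n) -> x = y.
Proof.
case: x => f Hf; case: y => g Hg /= /funext efg; subst g.
by congr MkZ2; apply: Prop_irrelevance.
Qed.

Lemma Z2_mod x n : (x n %% 2%:Z ^+ n)%Z = x n.
Proof. by rewrite Z2_coherent modz_mod. Qed.

Lemma Z2_modS x n : (x n.+1 %% 2%:Z ^+ n)%Z = (x n %% 2%:Z ^+ n)%Z.
Proof. by rewrite -Z2_coherent Z2_mod. Qed.

Lemma Z2_modD x m n : (x (n + m)%N %% 2%:Z ^+ n)%Z = x n.
Proof.
elim: m => [|m IH]; first by rewrite addn0 Z2_mod.
rewrite -{}IH (Z2_coherent x (n + m)) addnS modz_dvdm //.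
by rewrite exprD dvdz_mulr.
Qed.

Definition coherent g := forall n, (g n.+1 = g n %[mod 2%:Z ^+ n])%Z.

Lemma Z2_reduce_coherent g (cg : coherent g) n :
  (g n %% 2%:Z ^+ n)%Z = ((g n.+1 %% 2%:Z ^+ n.+1)%Z %% 2%:Z ^+ n)%Z.
Proof. by rewrite modz_dvdm ?cg // exprS dvdz_mull. Qed.

Definition Z2_reduce g (cg : coherent g) : Z2 := MkZ2 (Z2_reduce_coherent cg).

Lemma coherent_cst (a : int) : coherent (fun=> a).
Proof. by []. Qed.

Lemma coherentN x : coherent (fun n => - x n).
Proof. by move=> n; rewrite /= -modzNm Z2_modS modzNm. Qed.

Lemma coherentD x y : coherent (fun n => x n + y n).
Proof. by move=> n; rewrite /= -modzDm !Z2_modS modzDm. Qed.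

Lemma coherentM x y : coherent (fun n => x n * y n).
Proof. by move=> n; rewrite /= -modzMm !Z2_modS modzMm. Qed.

Definition Z2_cst a := Z2_reduce (coherent_cst a).
Definition Z2_opp x := Z2_reduce (coherentN x).
Definition Z2_add x y := Z2_reduce (coherentD x y).
Definition Z2_mul x y := Z2_reduce (coherentM x y).

Fact Z2_addA : associative Z2_add.
Proof. by move=> x y z; apply: Z2P => n /=; rewrite modzDml modzDmr addrA. Qed.
Fact Z2_addC : commutative Z2_add.
Proof. by move=> x y; apply: Z2P => n /=; rewrite addrC. Qed.
Fact Z2_add0 : left_id (Z2_cst 0) Z2_add.
Proof. by move=> x; apply: Z2P => n /=; rewrite modzDml add0r Z2_mod. Qed.
Fact Z2_addN : left_inverse (Z2_cst 0) Z2_opp Z2_add.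
Proof. by move=> x; apply: Z2P => n /=; rewrite modzDml addNr. Qed.

HB.instance Definition _ :=
  GRing.isZmodule.Build Z2 Z2_addA Z2_addC Z2_add0 Z2_addN.

Fact Z2_mulA : associative Z2_mul.
Proof. by move=> x y z; apply: Z2P => n /=; rewrite modzMml modzMmr mulrA. Qed.
Fact Z2_mulC : commutative Z2_mul.
Proof. by move=> x y; apply: Z2P => n /=; rewrite mulrC. Qed.
Fact Z2_mul1 : left_id (Z2_cst 1) Z2_mul.
Proof. by move=> x; apply: Z2P => n /=; rewrite modzMml mul1r Z2_mod. Qed.
Fact Z2_mulD : left_distributive Z2_mul Z2_add.
Proof.
by move=> x y z; apply: Z2P => n /=; rewrite modzMml modzDm mulrDl.
Qed.
Fact Z2_1neq0 : Z2_cst 1 != 0.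
Proof. by apply/eqP => /(congr1 (fun x : Z2 => x 1%N)). Qed.

HB.instance Definition _ := GRing.Zmodule_isComNzRing.Build Z2
  Z2_mulA Z2_mulC Z2_mul1 Z2_mulD Z2_1neq0.

Definition Z2_unit : {pred Z2} := fun x => `[< exists y, y * x = 1 >].
Definition Z2_inv x : Z2 :=
  if pselect (exists y, y * x = 1) is left Px then sval (cid Px) else x.

Fact Z2_mulV : {in Z2_unit, left_inverse 1 Z2_inv *%R}.
Proof.
move=> x /asboolP Ux; rewrite /Z2_inv; case: pselect => // Px.
exact: (svalP (cid Px)).
Qed.
Fact Z2_unitP x y : y * x = 1 -> Z2_unit x.
Proof. by move=> yx; apply/asboolP; exists y. Qed.
Fact Z2_inv_out : {in [predC Z2_unit], Z2_inv =1 id}.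
Proof.
by move=> x /asboolPn nUx; rewrite /Z2_inv; case: pselect.
Qed.

HB.instance Definition _ := GRing.ComNzRing_hasMulInverse.Build Z2
  Z2_mulV Z2_unitP Z2_inv_out.

Lemma dvdn_pow2_mul (m n a b : nat) :
  (2 ^ (m + n) %| a * b -> (2 ^ m %| a) || (2 ^ n %| b))%N.
Proof.
have [->|a0] := posnP a; first by rewrite dvdn0.
have [->|b0] := posnP b; first by rewrite dvdn0 orbT.
rewrite !pfactor_dvdn ?muln_gt0 ?a0 // lognM //.
by case: (leqP m) => //= am; case: (leqP n) => //= bn; rewrite leqNgt -addSn leq_add // ltnW.
Qed.

Fact Z2_idom : GRing.integral_domain_axiom Z2.
Proof.
move=> x y xy0; case: (eqVneq x 0) => //= x0; apply/eqP/Z2P => n.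
have [m xm] : exists m, x m != 0.
  apply: contrapT => /forallNP x_eq0; case/eqP: x0; apply: Z2P => m /=.
  by rewrite mod0z; apply/eqP; rewrite -[_ == _]negbK; apply/negP/x_eq0.
move: (congr1 (fun z : Z2 => z (m + n)%N) xy0) => /=.
rewrite !mod0z => /dvdz_mod0P.
rewrite dvdzE abszX abszM /= => /dvdn_pow2_mul /orP[|].
  rewrite -[X in (X ^ m)%N]/(`|2%:Z|%N) -abszX -dvdzE => /dvdz_mod0P.
  by rewrite Z2_modD => xm0; rewrite xm0 eqxx in xm.
rewrite -[X in (X ^ n)%N]/(`|2%:Z|%N) -abszX -dvdzE => /dvdz_mod0P.
by rewrite addnC Z2_modD.
Qed.

HB.instance Definition _ := GRing.ComUnitRing_isIntegral.Build Z2 Z2_idom.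

End Z2Theory.

Notation Q2 := {fraction Z2}.

(** The prefix na stands for "not necessarily associative". *)

Record naAlgebra (F : fieldType) := NaAlgebra {
  na_sort :> lmodType F;
  na_mul : na_sort -> na_sort -> na_sort;
  na_one : na_sort;
  na_mul_linearl : forall y, linear (na_mul^~ y);
  na_mul_linearr : forall x, linear (na_mul x);
  na_mul1x : left_id na_one na_mul;
  na_mulx1 : right_id na_one na_mul }.

Section NaAlgebra.
Variable F : fieldType.
Implicit Types A B : naAlgebra F.

Definition na_isomorphic A B : Prop :=
  exists f : {linear A -> B},
    bijective f /\ forall x y, f (na_mul x y) = na_mul (f x) (f y).

Definition left_nucleus A : set A :=
  [set x | forall y z, na_mul (na_mul x y) z = na_mul x (na_mul y z)]%classic.
Arguments left_nucleus : clear implicits.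

(* The left nucleus of A is, as an F-algebra, (isomorphic to) K. *)
Definition has_left_nucleus (K : fieldExtType F) A : Prop :=
  exists f : {linear K -> A},
    [/\ injective f, forall x y, f (x * y) = na_mul (f x) (f y)
      & range f = left_nucleus A]%classic.

End NaAlgebra.
Arguments left_nucleus {F} A.

Section Quaternion.
Variables (F : fieldType) (K : splittingFieldType F).

Definition quadratic_galois : Prop := \dim {:K} = 2%N /\ galois 1 {:K}.

Definition nontrivial_aut (sigma : gal_of {:K}) : Prop :=
  sigma \in 'Gal({:K} / 1)%g /\ sigma != 1%g.

Variables (sigma : gal_of {:K}) (a : K).

(* The pair (k, l) stands for k + l t. *)
Definition quat_mul (x y : K * K) : K * K :=
  (x.1 * y.1 + x.2 * sigma y.2 * a, x.1 * y.2 + x.2 * sigma y.1).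

Fact quat_mul_linearl y : linear (quat_mul^~ y).
Proof.
move=> c x x'; rewrite /quat_mul /=; congr pair => /=.
  by rewrite !mulrDl !scalerDr -!scalerAl addrACA.
by rewrite !mulrDl !scalerDr -!scalerAl addrACA.
Qed.
Fact quat_mul_linearr x : linear (quat_mul x).
Proof.
move=> c y y'; rewrite /quat_mul /=; congr pair => /=.
  by rewrite linearP !mulrDr !mulrDl !scalerDr -!scalerAr -!scalerAl addrACA.
by rewrite linearP !mulrDr !scalerDr -!scalerAr addrACA.
Qed.
Fact quat_mul1x : left_id (1, 0) quat_mul.
Proof. by case=> x y; rewrite /quat_mul /= !mul1r !mul0r !addr0. Qed.
Fact quat_mulx1 : right_id (1, 0) quat_mul.
Proof.
by case=> x y; rewrite /quat_mul /= rmorph0 rmorph1 !mulr1 !mulr0 mul0r addr0 add0r.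
Qed.

Definition quat_alg : naAlgebra F :=
  @NaAlgebra F (K * K)%type quat_mul (1, 0)
    quat_mul_linearl quat_mul_linearr quat_mul1x quat_mulx1.

End Quaternion.

Definition is_na_quaternion (F : fieldType) (A : naAlgebra F) : Prop :=
  exists (L : splittingFieldType F) (sigma : gal_of {:L}) (a : L),
    [/\ quadratic_galois L, nontrivial_aut sigma, a \notin 1%VS
      & na_isomorphic A (quat_alg sigma a)].

(* The (K/F, sigma, a) for a in S represent, each exactly once, the isomorphism
   classes of nonassociative quaternion algebras over F with left nucleus K. *)
Definition represents_once (F : fieldType) (K : splittingFieldType F)
    (sigma : gal_of {:K}) (S : set K) : Prop :=
  (forall a, S a -> a \notin 1%VS /\ has_left_nucleus K (quat_alg sigma a)) /\
  (forall A : naAlgebra F, is_na_quaternion A -> has_left_nucleus K A ->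
     exists! a, S a /\ na_isomorphic A (quat_alg sigma a)).

(* K = Q_2(r) with r a square root of c. *)
Definition is_sqrt_ext (c : int) (K : fieldExtType Q2) (r : K) : Prop :=
  r ^+ 2 = c%:~R /\ <<1; r>>%VS = {:K}%VS.

Definition ext_isomorphic (F : fieldType) (K L : fieldExtType F) : Prop :=
  exists f : {lrmorphism K -> L}, bijective f.

(* The valuation ring of K is the integral closure of Z_2; its maximal ideal
   is the set of its nonunits. *)
Definition int_ring (K : fieldExtType Q2) : set K :=
  [set x | integralOver (fun z : Z2 => in_alg K (tofrac z)) x]%classic.

Definition max_ideal (K : fieldExtType Q2) : set K :=
  [set x | int_ring x /\ ~ (x != 0 /\ int_ring x^-1)]%classic.

(* The ramification index e of K over Q_2, defined by 2 O_K = m_K ^ e, is 1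
   (the residue field being finite, separability is automatic). *)
Definition unramified (K : fieldExtType Q2) : Prop :=
  [set 2%:R * x | x in @int_ring K]%classic = @max_ideal K.

Definition is_norm (F : fieldType) (K : splittingFieldType F) (b : K) : Prop :=
  exists2 x : K, x != 0 & galNorm 1 {:K} x = b.

(* R is a set of representatives of the cosets of {1, -1} in Q_2^*. *)
Definition mod_sign_reps (R : set Q2) : Prop :=
  (forall s, R s -> s != 0) /\
  (forall x, x != 0 -> exists! s, R s /\ (s = x \/ s = - x)).

Section Reps.
Variables (K : fieldExtType Q2) (r : K) (R : set Q2).
Local Open Scope classical_set_scope.

Definition reps_a : set K :=
  [set r; 2%:R * r] `|` [set 1 + s *: r | s in R]
                    `|` [set 2%:R + s *: r | s in R].
Definition reps_b : set K :=
  [set r; 3%:R * r] `|` [set 1 + s *: r | s in R]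
                    `|` [set 3%:R + s *: r | s in R].
Definition reps_c : set K :=
  [set r] `|` [set 1 + s *: r | s in R] `|` [set -1 + s *: r | s in R].

End Reps.

(* Main.v *)
Require Import Defs.
From HB Require Import structures.
From mathcomp Require Import all_boot all_order all_algebra all_fingroup all_field.
From mathcomp Require Import boolp classical_sets.
From mathcomp Require Import ring.
Set Implicit Arguments.
Unset Strict Implicit.
Unset Printing Implicit Defensive.
Import Order.TTheory GRing.Theory Num.Theory.
Local Open Scope ring_scope.

(** The algebra (K/F, sigma, a) has left nucleus K, so an isomorphism onto
    (K/F, sigma, b) restricts to an automorphism tau of K. Because
    t x = sigma(x) t, it sends t to k t for some k in K, and comparing squares
    gives tau(a) = N(k) b; conversely any such pair (tau, k) defines an
    isomorphism ([quat_isomorphic_norm], [quat_isomorphicI]). An algebra that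
    is only abstractly a quaternion algebra with left nucleus K is brought to
    this form by [na_quaternion_over].

    With K = F(r), r^2 = c and a = x + y r, the classes are thus the pairs
    (x, y) with y nonzero, modulo scaling by the norms u^2 - c v^2 and modulo
    the sign of y ([quat_isomorphic_coord]). If the norm group has index 2 in
    F^* and n is a nonnorm, then a nonzero x is scaled to exactly one of 1 and
    n, after which only the sign of y is free; if x = 0, then y ranges over F^*
    modulo norms and sign, which is {1, n} or {1} according to whether -1 is a
    norm ([represents_once_coord]). This argument holds over any field where 2
    is invertible.

    The arithmetic of Q_2 enters in three ways. Hensel's lemma makes every
    number congruent to 1 modulo 8 a square, so that the square classes are
    represented by 1, 2, 3, 6 up to sign ([Q2_square_class]) and a number is
    shown to be a norm by computing one value of u^2 - c v^2 modulo 8. In the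
    other direction, a diagonal ternary form whose zeros modulo 16 have only
    even coordinates has no nontrivial zero, by descent ([Q2_anisotropic]): this
    separates the square classes, hence the seven extensions, and shows that n
    is not a norm ([Q2_norm_index2]). Finally an element of K is integral over
    Z_2 only if its norm is in Z_2: for c different from -3 there is an integral
    element whose norm is twice a unit, so 2 is ramified, while for c = -3 every
    integral element of even norm is divisible by 2. *)

(** * Arithmetic of the 2-adic integers *)

Lemma Z2_coordD (x y : Z2) n : (x + y) n = ((x n + y n) %% 2%:Z ^+ n)%Z.
Proof. by []. Qed.

Lemma Z2_coordN (x : Z2) n : (- x) n = (- x n %% 2%:Z ^+ n)%Z.
Proof. by []. Qed.

Lemma Z2_coordM (x y : Z2) n : (x * y) n = ((x n * y n) %% 2%:Z ^+ n)%Z.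
Proof. by []. Qed.

Lemma Z2_coord_int (a : int) n : (a%:~R : Z2) n = (a %% 2%:Z ^+ n)%Z.
Proof.
have Hnat m : (m%:R : Z2) n = (m%:Z %% 2%:Z ^+ n)%Z.
  elim: m => [|m IH] //.
  rewrite -[in LHS]addn1 natrD Z2_coordD IH /= modzDml modzDmr; congr (_ %% _)%Z.
  by rewrite -PoszD addn1.
case: a => m; first exact: Hnat.
by rewrite NegzE mulrNz Z2_coordN Hnat modzNm.
Qed.

Lemma Z2_coord_dvd (x : Z2) m n : (m <= n)%N ->
  x m = 0 -> (2%:Z ^+ m %| x n)%Z.
Proof.
move=> /subnKC <- xm; apply/dvdz_mod0P.
by rewrite Z2_modD.
Qed.

Lemma Z2_coord0 (x : Z2) : x 0%N = 0.
Proof. by rewrite -Z2_mod expr0 modz1. Qed.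

Lemma Z2_coord_mull0 (q d : Z2) n : d n = 0 -> (q * d) n = 0.
Proof. by move=> dn; rewrite Z2_coordM dn mulr0 mod0z. Qed.

Lemma Z2_coord_mul2 (d : Z2) n : d n = 0 -> (2%:R * d) n.+1 = 0.
Proof.
move=> dn; rewrite Z2_coordM (Z2_coord_int 2) modzMml exprS.
have /dvdzP[k ->] := Z2_coord_dvd (leqnSn n) dn.
by apply/dvdz_mod0P; rewrite mulrCA dvdz_mull.
Qed.

Lemma Z2_coord_sub0 (x y : Z2) n : ((x - y) n = 0) <-> (x n = y n).
Proof.
rewrite Z2_coordD Z2_coordN modzDmr; split=> [/dvdz_mod0P|->]; last first.
  by rewrite subrr mod0z.
by rewrite -eqz_mod_dvd => /eqP; rewrite !Z2_mod.
Qed.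

(** Banach's theorem for the 2-adic metric: the n-th iterate is already right
    modulo 2^n, so the diagonal sequence of coordinates is coherent. *)
Lemma Z2_fixpoint (f : Z2 -> Z2) :
  (forall x y, exists q, f x - f y = 2%:R * (q * (x - y))) ->
  exists z, f z = z.
Proof.
move=> fP.
have fS (x y : Z2) n : x n = y n -> f x n.+1 = f y n.+1.
  move=> /Z2_coord_sub0 xy; have [q fxy] := fP x y.
  by apply/Z2_coord_sub0; rewrite fxy; apply/Z2_coord_mul2/Z2_coord_mull0.
pose z k := iter k f 0.
have zS k : z k.+1 k = z k k.
  by elim: k => [|k IH]; [rewrite !Z2_coord0 | apply: fS].
have zc : coherent (fun k => z k k).
  by move=> k /=; rewrite Z2_modS zS.
exists (Z2_reduce zc); apply: Z2P => -[|n]; first by rewrite !Z2_coord0.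
rewrite [RHS]/= -/(f _) Z2_mod.
by apply: fS; rewrite /= Z2_mod.
Qed.

Lemma Z2_odd_unit (m : Z2) : exists y, (1 + 2%:R * m) * y = 1.
Proof.
have [|y yE] := @Z2_fixpoint (fun y => 1 - 2%:R * m * y).
  by move=> x y; exists (- m); ring.
by exists y; rewrite mulrDl mul1r -[X in X + _]yE; ring.
Qed.

(** Hensel's lemma for squares: (1 + 4 w)^2 = 1 + 8 m amounts to
    w = m - 2 w^2, whose right-hand side contracts in w. *)
Lemma Z2_sqrt (m : Z2) : exists s, s ^+ 2 = 1 + 8%:R * m.
Proof.
have [|w wE] := @Z2_fixpoint (fun w => m - 2%:R * w ^+ 2).
  by move=> x y; exists (- (x + y)); ring.
exists (1 + 4%:R * w).
have -> : m = w + 2%:R * w ^+ 2 by rewrite -[X in X + _]wE; ring.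
by ring.
Qed.

Lemma Z2_half (x : Z2) : x 1%N = 0 -> exists y, x = 2%:R * y.
Proof.
move=> x1; have ev n : (2 %| x n.+1)%Z by apply: (Z2_coord_dvd (m := 1)).
have hc : coherent (fun n => (x n.+1 %/ 2)%Z).
  move=> n; apply/eqP; rewrite eqz_mod_dvd.
  have : (2%:Z ^+ n.+1 %| x n.+2 - x n.+1)%Z.
    by rewrite -eqz_mod_dvd Z2_modS.
  rewrite -{1}(divzK (ev n.+1)) -{1}(divzK (ev n)) -mulrBl exprSr.
  by rewrite dvdz_mul2r.
exists (Z2_reduce hc); apply: Z2P => n.
rewrite Z2_coordM (Z2_coord_int 2) modzMml /= modzMmr mulrC divzK //.
by rewrite Z2_modS Z2_mod.
Qed.

Lemma Z2_parity (x : Z2) : exists y, x = 2%:R * y \/ x = 1 + 2%:R * y.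
Proof.
have : (x 1%N == 0) || (x 1%N == 1).
  rewrite -Z2_mod expr1; have := modz_ge0 (x 1%N) (isT : 2%:Z != 0).
  have := ltz_pmod (x 1%N) (isT : 0 < 2%:Z).
  by case: (x 1%N %% 2)%Z => [[|[|]]|].
case/orP => /eqP x1.
  by have [y ->] := Z2_half x1; exists y; left.
have [|y xy] := @Z2_half (x - 1); last by exists y; right; rewrite -xy addrC subrK.
by apply/Z2_coord_sub0.
Qed.

Lemma Z2_odd_neq_even (y z : Z2) : 1 + 2%:R * y <> 2%:R * z.
Proof.
have dbl0 (t : Z2) : (2%:R * t) 1%N = 0 by apply/Z2_coord_mul2/Z2_coord0.
move=> E; have : (1 : Z2) 1%N = (2%:R * (z - y)) 1%N.
  by congr (Z2_val _ 1%N); rewrite mulrBr -E addrK.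
by rewrite dbl0.
Qed.

Lemma Z2_int_eq0 (a : int) : (a%:~R == 0 :> Z2) = (a == 0).
Proof.
apply/eqP/eqP => [a0|->//].
have := Z2_coord_int a `|a|%N; rewrite a0 => /esym aE.
have /dvdz_mod0P : (a %% 2%:Z ^+ `|a|%N)%Z = 0 by rewrite aE /= mod0z.
rewrite dvdzE abszX /= => /dvdn_leq; rewrite absz_gt0.
by case: eqP => // _ /(_ isT); rewrite leqNgt ltn_expl.
Qed.

(** Dividing by 2 shifts the coordinates, so the index of a nonzero coordinate
    bounds the number of possible divisions. *)
Lemma Z2_pow2_odd (x : Z2) : x != 0 ->
  exists k y, x = 2%:R ^+ k * (1 + 2%:R * y).
Proof.
move=> x0; have [n xn] : exists n, x n != 0.
  apply: contrapT => /forallNP xE; case/eqP: x0; apply: Z2P => n /=.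
  by rewrite mod0z; apply/eqP; rewrite -[_ == _]negbK; apply/negP/xE.
elim: n x {x0} xn => [|n IH] x; first by rewrite Z2_coord0.
have [y [->|->]] := Z2_parity x; last by exists 0%N, y; rewrite mul1r.
move=> xn; have [|k [z ->]] := IH y.
  by apply: contra_neq xn => /Z2_coord_mul2.
by exists k.+1, z; rewrite exprS mulrA.
Qed.

(** * Square classes and diagonal forms over the 2-adic numbers *)

Definition square_class_reps : seq int := [:: 1; -1; 2; -2; 3; -3; 6; -6].

Lemma Q2_int_eq0 (a : int) : (a%:~R == 0 :> Q2) = (a == 0).
Proof. by rewrite -(rmorph_int (@tofrac Z2)) tofrac_eq0 Z2_int_eq0. Qed.

Lemma Q2_nat_eq0 n : (n%:R == 0 :> Q2) = (n == 0%N).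
Proof. exact: (Q2_int_eq0 n). Qed.

Lemma fraction_quotient (R : idomainType) (q : {fraction R}) :
  exists x y : R, y != 0 /\ q = tofrac x / tofrac y.
Proof.
elim/quotW: q => -[[x y] /= y0]; exists x, y; split=> //.
apply: (canRL (mulfK _)); first by rewrite tofrac_eq0.
unlock tofrac; rewrite -[LHS]FracField.pi_mul; apply/eqmodP => /=.
rewrite FracField.equivfE /FracField.mulf /= !numden_Ratio ?oner_neq0 ?mulr1 //.
by rewrite mulrC.
Qed.

(** Modulo 8 an odd integer is one of the four odd representatives e, and then
    its product with e is 1 modulo 8, hence a square. *)
Lemma Z2_odd_class (y : Z2) : exists (e : int) (s : Z2),
  e \in [:: 1; -1; 3; -3] /\ e%:~R * (1 + 2%:R * y) = s ^+ 2.
Proof.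
have [z [->|->]] := Z2_parity y; have [t [->|->]] := Z2_parity z.
- have [s sE] := Z2_sqrt t; exists 1, s; split=> //; rewrite sE; ring.
- have [s sE] := Z2_sqrt (- 2%:R - 3%:R * t); exists (-3), s; split=> //; rewrite sE; ring.
- have [s sE] := Z2_sqrt (1 + 3%:R * t); exists 3, s; split=> //; rewrite sE; ring.
- have [s sE] := Z2_sqrt (-1 - t); exists (-1), s; split=> //; rewrite sE; ring.
Qed.

Lemma Z2_square_class (x : Z2) : x != 0 -> exists (e : int) (s : Q2),
  [/\ e \in square_class_reps, s != 0 & tofrac x = e%:~R * s ^+ 2].
Proof.
move=> x0; have [k [y xE]] := Z2_pow2_odd x0.
have [e [s [eR sE]]] := Z2_odd_class y.
have e0 : (e%:~R : Q2) != 0 by rewrite Q2_int_eq0; apply: contraL eR => /eqP ->.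
have u0 : 1 + 2%:R * y != 0 by apply: contraNneq x0 => u0; rewrite xE u0 mulr0.
have s0 : tofrac s != 0.
  rewrite tofrac_eq0; apply: contraNneq u0 => s0.
  move/eqP: sE; rewrite s0 expr0n mulf_eq0 Z2_int_eq0.
  by case/orP=> // /eqP e00; rewrite e00 in eR.
have two0 : (2%:R : Q2) != 0 by rewrite Q2_nat_eq0.
exists ((2%:Z ^+ odd k) * e), (2%:R ^+ k./2 * (tofrac s / e%:~R)); split.
- by case: (odd k); move: eR; rewrite !inE => /or4P[] /eqP ->.
- by rewrite !mulf_neq0 ?expf_neq0 ?invr_eq0.
have uE : tofrac (1 + 2%:R * y) = tofrac s ^+ 2 / e%:~R.
  by rewrite -rmorphXn -sE rmorphM rmorph_int /= [_%:~R * _]mulrC mulfK.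
rewrite xE rmorphM /= uE rmorphXn rmorph_nat rmorphM rmorphXn /=.
rewrite -{1}(odd_double_half k) exprD -muln2 exprM.
have clear_denom (F : fieldType) (o h t e' : F) : e' != 0 ->
    o * h ^+ 2 * (t ^+ 2 / e') = o * e' * (h * (t / e')) ^+ 2 by move=> ?; field.
rewrite -pmulrn; exact: (clear_denom Q2 _ _ _ _ e0).
Qed.

Lemma Q2_square_class (q : Q2) : q != 0 -> exists (e : int) (s : Q2),
  [/\ e \in square_class_reps, s != 0 & q = e%:~R * s ^+ 2].
Proof.
have [x [y [y0 ->]]] := fraction_quotient q => q0.
have x0 : x != 0 by apply: contraNneq q0 => ->; rewrite rmorph0 mul0r.
have [e [s [eR s0 sE]]] := Z2_square_class (mulf_neq0 x0 y0).
have y0' : tofrac y != 0 by rewrite tofrac_eq0.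
exists e, (s / tofrac y); split=> //; first by rewrite mulf_neq0 ?invr_eq0.
by rewrite expr_div_n mulrA -sE rmorphM /= expr2 invfM mulrA mulfK.
Qed.

Lemma Z2_square_mod16 (u : Z2) : exists (q : int) (m : Z2),
  u ^+ 2 = q%:~R + 16%:R * m /\
  ((q \in [:: 0; 4]) /\ (exists y, u = 2%:R * y) \/ q \in [:: 1; 9]).
Proof.
have [y [->|->]] := Z2_parity u; have [z [->|->]] := Z2_parity y.
- by exists 0, (z ^+ 2); split; [ring | left; split=> //; exists (2%:R * z)].
- exists 4, (z + z ^+ 2); split; [ring | left; split=> //].
  by exists (1 + 2%:R * z).
- have [t [->|->]] := Z2_parity z.
    by exists 1, (t + 4%:R * t ^+ 2); split; [ring | right].
  by exists 9, (1 + 5%:R * t + 4%:R * t ^+ 2); split; [ring | right].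
- have [t [->|->]] := Z2_parity z.
    by exists 9, (3%:R * t + 4%:R * t ^+ 2); split; [ring | right].
  by exists 1, (3%:R + 7%:R * t + 4%:R * t ^+ 2); split; [ring | right].
Qed.

(** The squares modulo 16 are 0, 4 (of even numbers) and 1, 9 (of odd ones), so
    this is the condition that every zero of a u^2 + b v^2 + c w^2 modulo 16 has
    all its coordinates even. *)
Definition anisotropic_mod16 (a b c : int) : bool :=
  all (fun x => all (fun y => all (fun z =>
    (16 %| a * x + b * y + c * z)%Z ==>
      [&& x \in [:: 0; 4], y \in [:: 0; 4] & z \in [:: 0; 4]])
    [:: 0; 4; 1; 9]) [:: 0; 4; 1; 9]) [:: 0; 4; 1; 9].

Lemma Z2_16_dvd (a : int) (m : Z2) : a%:~R = 16%:R * m -> (16 %| a)%Z.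
Proof.
move=> /(congr1 (fun x : Z2 => x 4%N)).
have E16 : (16%:R : Z2) 4%N = 0 by rewrite pmulrn Z2_coord_int.
have Em : (16%:R * m) 4%N = 0.
  by rewrite (mulrC 16%:R m); exact: Z2_coord_mull0 E16.
rewrite Em Z2_coord_int => aE.
by apply/dvdz_mod0P.
Qed.

(** Infinite descent: the coordinates of a zero are even, and their halves form
    a zero again, so they are divisible by every power of 2. *)
Lemma Z2_anisotropic (a b c : int) (u v w : Z2) : anisotropic_mod16 a b c ->
  a%:~R * u ^+ 2 + b%:~R * v ^+ 2 + c%:~R * w ^+ 2 = 0 -> [/\ u = 0, v = 0 & w = 0].
Proof.
move=> chk E; suff H n : [/\ u n = 0, v n = 0 & w n = 0].
  by split; apply: Z2P => n; have [] := H n; rewrite /= mod0z.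
elim: n u v w E => [|n IH] u v w E; first by rewrite !Z2_coord0.
have mem (q : int) (x : Z2) : (q \in [:: 0; 4]) /\ (exists y, x = 2%:R * y) \/ q \in [:: 1; 9] ->
    q \in [:: 0; 4; 1; 9].
  by rewrite !inE; case=> [[/orP[] -> //]|/orP[] ->]; rewrite ?orbT.
have half (q : int) (x : Z2) : (q \in [:: 0; 4]) /\ (exists y, x = 2%:R * y) \/ q \in [:: 1; 9] ->
    q \in [:: 0; 4] -> exists y, x = 2%:R * y.
  by case=> [[]//|]; rewrite !inE => /orP[] /eqP ->.
have [x [k [uE Hx]]] := Z2_square_mod16 u.
have [y [l [vE Hy]]] := Z2_square_mod16 v.
have [z [m [wE Hz]]] := Z2_square_mod16 w.
have /Z2_16_dvd D : (a * x + b * y + c * z)%:~R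
    = 16%:R * (- (a%:~R * k + b%:~R * l + c%:~R * m)) :> Z2.
  apply/eqP; rewrite -subr_eq0; apply/eqP; rewrite -[RHS]E uE vE wE; ring.
have /(allP chk)/allP/(_ _ (mem _ _ Hy))/allP/(_ _ (mem _ _ Hz)) := mem _ _ Hx.
rewrite D => /and3P[/(half _ _ Hx)[u' uD] /(half _ _ Hy)[v' vD] /(half _ _ Hz)[w' wD]].
have [] := IH u' v' w'.
  apply: (@mulfI _ (4%:R : Z2)); first by rewrite pmulrn Z2_int_eq0.
  by rewrite mulr0 -E uD vD wD; ring.
by rewrite uD vD wD => ? ? ?; split; apply: Z2_coord_mul2.
Qed.

Lemma Q2_anisotropic (a b c : int) (u v w : Q2) : anisotropic_mod16 a b c ->
  a%:~R * u ^+ 2 + b%:~R * v ^+ 2 + c%:~R * w ^+ 2 = 0 -> [/\ u = 0, v = 0 & w = 0].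
Proof.
have [u1 [u2 [u20 ->]]] := fraction_quotient u.
have [v1 [v2 [v20 ->]]] := fraction_quotient v.
have [w1 [w2 [w20 ->]]] := fraction_quotient w.
have [U0 V0 W0] : [/\ tofrac u2 != 0, tofrac v2 != 0 & tofrac w2 != 0].
  by rewrite !tofrac_eq0.
move=> chk E; have [] := @Z2_anisotropic a b c (u1 * v2 * w2) (v1 * u2 * w2) (w1 * u2 * v2) chk.
  apply/eqP; rewrite -tofrac_eq0 !(rmorphD, rmorphM, rmorphXn, rmorph_int) /=.
  have clear_denom (F : fieldType) (a' b' c' x x' y y' z z' : F) :
      [/\ x' != 0, y' != 0 & z' != 0] ->
      a' * (x * y' * z') ^+ 2 + b' * (y * x' * z') ^+ 2 + c' * (z * x' * y') ^+ 2
    = (x' * y' * z') ^+ 2 * (a' * (x / x') ^+ 2 + b' * (y / y') ^+ 2 + c' * (z / z') ^+ 2).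
    by case=> ? ? ?; field; apply/and3P.
  by rewrite (clear_denom _ _ _ _ _ _ _ _ _ _ (And3 U0 V0 W0)) E mulr0.
move=> /eqP; rewrite !mulf_eq0 (negPf v20) (negPf w20) !orbF => /eqP ->.
move=> /eqP; rewrite !mulf_eq0 (negPf u20) (negPf w20) !orbF => /eqP ->.
move=> /eqP; rewrite !mulf_eq0 (negPf u20) (negPf v20) !orbF => /eqP ->.
by rewrite !rmorph0 !mul0r.
Qed.

(** For distinct e and f, some b makes e u^2 + b v^2 - f w^2 anisotropic modulo
    16, and an equality e u^2 = f w^2 is a zero of that form with v = 0. *)
Lemma square_class_reps_inj (e f : int) (u w : Q2) :
  e \in square_class_reps -> f \in square_class_reps -> u != 0 ->
  e%:~R * u ^+ 2 = f%:~R * w ^+ 2 -> e = f.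
Proof.
move=> eR fR u0 E; apply: contraNeq u0 => ef.
have : all (fun e => all (fun f => (e == f) ||
    has (fun b => anisotropic_mod16 e b (- f)) square_class_reps)
    square_class_reps) square_class_reps by vm_compute.
move/allP/(_ e eR)/allP/(_ f fR); rewrite (negPf ef) => /hasP[b _ chk].
have [|-> //] := @Q2_anisotropic e b (- f) u 0 w chk.
by rewrite expr0n mulr0 addr0 E rmorphN mulNr subrr.
Qed.

(** * Values of the norm form u^2 - c v^2 *)

Definition norm_value (F : fieldType) (c x : F) : Prop :=
  exists u v, x = u ^+ 2 - c * v ^+ 2.

Section NormValues.
Variables (F : fieldType) (c : F).

Lemma norm_value_sqr (s : F) : norm_value c (s ^+ 2).
Proof. by exists s, 0; rewrite expr0n mulr0 subr0. Qed.

Lemma norm_valueM x y : norm_value c x -> norm_value c y -> norm_value c (x * y).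
Proof.
move=> [u [v ->]] [u' [v' ->]].
by exists (u * u' + c * v * v'), (u * v' + v * u'); ring.
Qed.

Lemma norm_valueV x : norm_value c x -> norm_value c x^-1.
Proof.
have [-> //|x0 Nx] := eqVneq x 0; first by rewrite invr0.
have -> : x^-1 = x * x^-1 ^+ 2 by rewrite expr2 mulrA mulfV // mul1r.
exact: norm_valueM Nx (norm_value_sqr _).
Qed.

Lemma norm_value_div x y :
  norm_value c x -> norm_value c y -> norm_value c (x / y).
Proof. by move=> Nx /norm_valueV; apply: norm_valueM. Qed.

End NormValues.

(** The norm group has index 2 in the multiplicative group of F, and n
    represents the nontrivial coset. *)
Definition norm_index2 (F : fieldType) (c n : F) : Prop :=
  [/\ n != 0, ~ norm_value c n
    & forall x, x != 0 -> norm_value c x \/ norm_value c (x / n)].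

Lemma Q2_int_sqr (t m : int) : exists s : Q2, (t ^+ 2 * (1 + 8 * m))%:~R = s ^+ 2.
Proof.
have [s sE] := Z2_sqrt m%:~R.
exists (t%:~R * tofrac s).
rewrite exprMn -(rmorphXn (@tofrac Z2)) sE rmorphM rmorphXn; congr (_ * _).
by rewrite !rmorphD !rmorphM rmorph_int !rmorph1 !rmorph_nat.
Qed.

(** That a is t^2 times a number congruent to 1 modulo 8; taking t up to 4 is
    enough for the squares used below. *)
Definition sqr_mod8 (a : int) : bool :=
  has (fun t : int => (8 * t ^+ 2 %| a - t ^+ 2)%Z) [:: 1; 2; 4].

Lemma sqr_mod8P (a : int) : sqr_mod8 a -> a != 0 /\ exists s : Q2, a%:~R = s ^+ 2.
Proof.
case/hasP => t tl /dvdzP[m aE].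
have {}aE : a = t ^+ 2 * (1 + 8 * m) by rewrite -(subrK (t ^+ 2) a) aE; ring.
split; last by have [s sE] := Q2_int_sqr t m; exists s; rewrite aE.
rewrite aE mulf_neq0 //; first by move: tl; rewrite !inE => /or3P[] /eqP ->.
apply/eqP => E; have : (8%:Z %| 1)%Z => //.
apply/dvdzP; exists (- m); apply/eqP.
by rewrite -subr_eq0 -[X in _ == X]E; apply/eqP; ring.
Qed.

(** A number is a norm as soon as its product with some nonzero norm is a
    square, so small integers u and v suffice to find the 2-adic norms among the
    representatives of the square classes. *)
Definition norm_value_mod8 (c e : int) : bool :=
  has (fun u : int => has (fun v : int => sqr_mod8 (e * (u ^+ 2 - c * v ^+ 2)))
    [:: 0; 1; 2; 3]) [:: 0; 1; 2; 3].

Lemma norm_value_mod8P (c e : int) :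
  norm_value_mod8 c e -> norm_value (c%:~R : Q2) e%:~R.
Proof.
case/hasP => u _ /hasP[v _] /sqr_mod8P[ek0 [s sE]].
move: ek0; rewrite mulf_eq0 negb_or => /andP[e0 k0].
set k := u ^+ 2 - c * v ^+ 2 in sE k0.
have {}k0 : (k%:~R : Q2) != 0 by rewrite Q2_int_eq0.
have -> : (e%:~R : Q2) = k%:~R * (s / k%:~R) ^+ 2.
  rewrite expr_div_n -sE rmorphM /=.
  have clear_denom (F : fieldType) (x y : F) : y != 0 -> x = y * (x * y / y ^+ 2).
    by move=> ?; field.
  exact: clear_denom.
apply: norm_valueM (norm_value_sqr _ _); exists u%:~R, v%:~R.
by rewrite /k rmorphB rmorphXn rmorphM rmorphXn.
Qed.

(** Each radicand c comes with the nonnorm n used to represent the nontrivial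
    norm class. *)
Definition norm_nonnorm : seq (int * int) :=
  [:: (-3, 2); (2, 3); (-6, 3); (-1, -1); (-2, -1); (3, -1); (6, -1)].

(** That n is not a norm is the anisotropy of u^2 - c v^2 - n w^2; for the index
    it is enough that, for each square class e, one of e and n e contains a
    norm. *)
Lemma Q2_norm_index2 (c n : int) : (c, n) \in norm_nonnorm ->
  norm_index2 (c%:~R : Q2) n%:~R.
Proof.
move=> cn.
have : all (fun p => [&& p.2 != 0, anisotropic_mod16 1 (- p.1) (- p.2)
    & all (fun e => norm_value_mod8 p.1 e || norm_value_mod8 p.1 (p.2 * e))
        square_class_reps]) norm_nonnorm by vm_compute.
move=> /allP; move/(_ (c, n) cn); rewrite /fst /snd => /and3P[n0 chk /allP tbl].
have n0' : (n%:~R : Q2) != 0 by rewrite Q2_int_eq0.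
split=> // [[u [v nE]]|x x0].
  have [|_ _ /eqP] := @Q2_anisotropic 1 (- c) (- n) u v 1 chk.
    by rewrite !mulrNz mul1r !mulNr expr1n mulr1 nE subrr.
  by rewrite oner_eq0.
have [e [s [eR s0 ->]]] := Q2_square_class x0.
case/orP: (tbl e eR) => /norm_value_mod8P Ne; [left|right].
  exact: norm_valueM Ne (norm_value_sqr _ _).
have clear_denom (F : fieldType) (n' y t : F) : n' != 0 ->
    y * t ^+ 2 / n' = n' * y * (t / n') ^+ 2 by move=> ?; field.
rewrite clear_denom //; apply: norm_valueM (norm_value_sqr _ _).
by rewrite -rmorphM.
Qed.

Lemma Q2_norm_values_N1 (c : int) : c \in [:: -3; 2; -6] -> norm_value (c%:~R : Q2) (-1).
Proof.
move=> cl; have : all (fun c => norm_value_mod8 c (-1)) [:: -3; 2; -6] by vm_compute.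
by move/allP/(_ c cl)/norm_value_mod8P; rewrite rmorphN1.
Qed.

(** * Quadratic extensions generated by a square root *)

Section QuadraticExtension.
Variables (F : fieldType) (K : fieldExtType F) (r : K).
Hypotheses (dimK : \dim {:K} = 2%N) (rF : r \notin 1%VS).

Lemma adjoin_quadratic : (1 + <[r]>)%VS = {:K}%VS.
Proof.
apply/eqP; rewrite eqEdim subvf dimK /=.
rewrite ltnNge; apply: contra rF => dim1.
have /eqP -> : (1%VS : {vspace K}) == (1 + <[r]>)%VS.
  by rewrite eqEdim addvSl dimv1.
by rewrite -[X in X \in _]add0r memv_add ?mem0v ?memv_line.
Qed.

Lemma quadratic_generator : <<1; r>>%VS = {:K}%VS.
Proof.
apply/eqP; rewrite eqEsubv subvf /= -adjoin_quadratic subv_add sub1v.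
by rewrite -memvE memv_adjoin.
Qed.

Lemma quadratic_coord x : exists u v, x = u%:A + v *: r.
Proof.
have : x \in (1 + <[r]>)%VS by rewrite adjoin_quadratic memvf.
case/memv_addP => _ /vlineP[u ->] [_ /vlineP[v ->] ->].
by exists u, v.
Qed.

Lemma quadratic_coord_inj u v u' v' :
  u%:A + v *: r = u'%:A + v' *: r -> u = u' /\ v = v'.
Proof.
move=> E; have {}E : (u - u')%:A = (v' - v) *: r.
  by rewrite !scalerBl; apply/eqP; rewrite subr_eq addrAC [X in X - _]addrC -E addrK.
have [vv|vv] := eqVneq v v'.
  split=> //; move/eqP: E; rewrite vv subrr scale0r scaler_eq0 oner_eq0 orbF.
  by rewrite subr_eq0 => /eqP.
case/negP: rF; apply/vlineP; exists ((v' - v)^-1 * (u - u')).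
by rewrite -scalerA E scalerK // subr_eq0 eq_sym.
Qed.

Lemma quadratic_coord_in1 u v : (u%:A + v *: r \in 1%VS) = (v == 0).
Proof.
apply/idP/eqP => [/vlineP[w E]|->]; last first.
  by rewrite scale0r addr0 rpredZ ?mem1v.
have [|_ ->] // := @quadratic_coord_inj u v w 0.
by rewrite scale0r addr0.
Qed.

End QuadraticExtension.

(** The minimal polynomial of r divides X^2 - c, and it is not linear because r
    is not in F. *)
Lemma sqrt_ext_dim (F : fieldType) (K : fieldExtType F) (r : K) (c : F) :
  r ^+ 2 = c%:A -> r \notin 1%VS -> <<1; r>>%VS = {:K}%VS -> \dim {:K} = 2%N.
Proof.
move=> r2 rF <-; rewrite dim_Fadjoin dimv1 muln1.
apply/eqP; rewrite eqn_leq; apply/andP; split; last first.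
  by rewrite ltn_neqAle eq_sym adjoin_deg_eq1 rF.
pose p : {poly K} := 'X^2 - (c%:A)%:P.
have pF : p \is a polyOver 1%VS.
  by rewrite rpredB ?rpredX ?polyOverX // polyOverC rpredZ ?mem1v.
have sp : size p = 3%N by rewrite size_XnsubC.
rewrite -ltnS -size_minPoly -sp; apply: dvdp_leq; first by rewrite -size_poly_gt0 sp.
by apply: minPoly_dvdp => //; rewrite /root !hornerE r2 subrr.
Qed.

Lemma splitting_poly_sqrt (F : fieldType) (K : fieldExtType F) (r : K) (c : F) :
  r ^+ 2 = c%:A -> <<1; r>>%VS = {:K}%VS ->
  let p := \prod_(x <- [:: r; - r]) ('X - x%:P) in
  p \is a polyOver 1%VS /\ splittingFieldFor 1 p {:K}.
Proof.
move=> r2 rK p; have pE : p = 'X^2 - (c%:A)%:P.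
  by rewrite /p big_cons big_seq1 -r2 polyCN rmorphXn /=; ring.
split; first by rewrite pE rpredB ?rpredX ?polyOverX // polyOverC rpredZ ?mem1v.
exists [:: r; - r]; first exact: eqpxx.
apply/eqP; rewrite eqEsubv subvf /= -rK; apply/FadjoinP; split; first exact: sub1v.
by apply: seqv_sub_adjoin; rewrite mem_head.
Qed.

Lemma gal_quadratic (F : fieldType) (K : splittingFieldType F) (sigma : gal_of {:K}) :
  quadratic_galois K -> nontrivial_aut sigma ->
  ('Gal({:K} / 1) = [set 1; sigma])%g.
Proof.
move=> [dimK galK] [sG s1]; apply/esym/eqP; rewrite eqEcard; apply/andP; split.
  by apply/fintype.subsetP => g; rewrite !inE => /orP[] /eqP ->.
by rewrite cards2 eq_sym s1 -galois_dim // dimK dimv1.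
Qed.

Lemma quadratic_fixed (F : fieldType) (K : splittingFieldType F) (sigma : gal_of {:K}) x :
  quadratic_galois K -> nontrivial_aut sigma -> sigma x = x -> x \in 1%VS.
Proof.
move=> gK sP sx; have [_ galK] := gK.
have /galois_fixedField <- := galK.
rewrite (gal_quadratic gK sP); apply/fixedFieldP; first exact: memvf.
by move=> g; rewrite !inE => /orP[] /eqP -> //; rewrite gal_id.
Qed.

Section QuadraticGalois.
Variables (F : fieldType) (K : splittingFieldType F) (r : K) (c : F).
Hypotheses (two0 : (2%:R : F) != 0) (dimK : \dim {:K} = 2%N).
Hypotheses (rF : r \notin 1%VS) (r2 : r ^+ 2 = c%:A).

Lemma sqrt_neq_opp : r != - r.
Proof.
apply: contra rF => /eqP rN; have : r *+ 2 = 0 by rewrite mulr2n {1}rN addNr.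
by rewrite -scaler_nat => /eqP; rewrite scaler_eq0 (negPf two0) => /eqP ->; rewrite mem0v.
Qed.

Lemma sqrt_quadratic_galois : quadratic_galois K.
Proof.
split=> //; apply/splitting_galoisField.
have [pF pS] := splitting_poly_sqrt r2 (quadratic_generator dimK rF).
eexists; split; [exact: pF | | exact: pS].
by rewrite separable_prod_XsubC /= inE sqrt_neq_opp.
Qed.

Variable sigma : gal_of {:K}.
Hypothesis sigmaP : nontrivial_aut sigma.

Lemma aut_sqrt : sigma r = - r.
Proof.
have [_ s1] := sigmaP.
have : sigma r ^+ 2 = r ^+ 2 by rewrite -rmorphXn /= r2 linearZ /= rmorph1.
move/eqP; rewrite eqf_sqr => /orP[/eqP sr|/eqP //].
case/negP: s1; apply/gal_eqP => x _.
have [u [v ->]] := quadratic_coord dimK rF x.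
by rewrite gal_id linearD !linearZ /= rmorph1 sr.
Qed.

Lemma aut_coord u v : sigma (u%:A + v *: r) = u%:A - v *: r.
Proof. by rewrite linearD !linearZ /= rmorph1 aut_sqrt scalerN. Qed.

Lemma mul_aut_coord u v :
  (u%:A + v *: r) * sigma (u%:A + v *: r) = (u ^+ 2 - c * v ^+ 2)%:A.
Proof.
rewrite aut_coord mulrC -subr_sqr !exprZn r2 expr1n scalerA.
by rewrite -scalerBl [c * _]mulrC.
Qed.

Lemma galNorm_quadratic x : galNorm 1 {:K} x = x * sigma x.
Proof.
have -> : galNorm 1 {:K} x = \prod_(f in [set 1%g; sigma]) f x.
  by rewrite -(gal_quadratic sqrt_quadratic_galois sigmaP).
by rewrite big_setU1 ?big_set1 /= ?gal_id // inE eq_sym; case: sigmaP.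
Qed.

End QuadraticGalois.

Lemma exists_nontrivial_aut (F : fieldType) (K : splittingFieldType F) :
  quadratic_galois K -> exists sigma : gal_of {:K}, nontrivial_aut sigma.
Proof.
case=> dimK galK; have : (1 < #|'Gal({:K} / 1)%g|)%N by rewrite -galois_dim // dimK dimv1.
rewrite cardG_gt1 => /trivgPn[s sG s1]; by exists s.
Qed.

(** * Isomorphisms of nonassociative quaternion algebras *)

Section NaIsomorphism.
Variable F : fieldType.
Implicit Types A B C : naAlgebra F.

Lemma na_isomorphicI A B (f : A -> B) : linear f -> bijective f ->
  (forall x y, f (na_mul x y) = na_mul (f x) (f y)) -> na_isomorphic A B.
Proof.
move=> fL fB fM.
pose fP := GRing.isLinear.Build _ _ _ _ f fL.
by exists (HB.pack f fP : {linear A -> B}).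
Qed.

Lemma na_isomorphic_sym A B : na_isomorphic A B -> na_isomorphic B A.
Proof.
case=> f [[g fK gK] fM]; apply: (@na_isomorphicI _ _ g).
- by move=> a x y; rewrite -{1}(gK x) -{1}(gK y) -linearP fK.
- by exists f.
by move=> x y; rewrite -{1}(gK x) -{1}(gK y) -fM fK.
Qed.

Lemma na_isomorphic_trans A B C :
  na_isomorphic A B -> na_isomorphic B C -> na_isomorphic A C.
Proof.
case=> f [fB fM] [g [gB gM]]; apply: (@na_isomorphicI _ _ (g \o f)).
- by move=> a x y; rewrite /= !linearP.
- exact: bij_comp.
by move=> x y; rewrite /= fM gM.
Qed.

Lemma na_iso_left_nucleus A B (f : {linear A -> B}) :
  bijective f -> (forall x y, f (na_mul x y) = na_mul (f x) (f y)) ->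
  forall x, left_nucleus B (f x) <-> left_nucleus A x.
Proof.
move=> [g fK gK] fM x; split=> Hx y z.
  by apply: (can_inj fK); rewrite !fM; apply: Hx.
by rewrite -(gK y) -(gK z) -!fM Hx.
Qed.

Lemma na_iso_one A B (f : {linear A -> B}) :
  bijective f -> (forall x y, f (na_mul x y) = na_mul (f x) (f y)) ->
  f (na_one A) = na_one B.
Proof.
move=> [g fK gK] fM.
by rewrite -[LHS]na_mulx1 -[X in na_mul _ X]gK -fM na_mul1x gK.
Qed.

End NaIsomorphism.

(** An isomorphism phi : L -> K commuting with the automorphisms extends by
    x + y t |-> phi x + phi y k t as soon as t^2 and (k t)^2 correspond. *)
Lemma quat_isomorphicI (F : fieldType) (L K : splittingFieldType F)
    (sL : gal_of {:L}) (sK : gal_of {:K}) (phi : L -> K) (a : L) (b k : K) :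
  linear phi -> bijective phi -> (forall x y, phi (x * y) = phi x * phi y) ->
  (forall x, phi (sL x) = sK (phi x)) -> k != 0 -> phi a = k * sK k * b ->
  na_isomorphic (quat_alg sL a) (quat_alg sK b).
Proof.
move=> phiL [psi phiK psiK] phiM phis k0 ab.
have phiD x y : phi (x + y) = phi x + phi y.
  by have := phiL 1 x y; rewrite !scale1r.
pose f (x : quat_alg sL a) : quat_alg sK b := (phi x.1, phi x.2 * k).
apply: (@na_isomorphicI _ _ _ f).
- move=> c x y; rewrite /f /=; congr pair; first exact: phiL.
  by rewrite phiL mulrDl -scalerAl.
- exists (fun x : quat_alg sK b => (psi x.1, psi (x.2 / k)) : quat_alg sL a).
    by case=> x y; rewrite /f /= mulfK // !phiK.
  by case=> x y; rewrite /f /= !psiK divfK.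
move=> [x1 x2] [y1 y2]; rewrite /f /= /quat_mul /=; congr pair.
  by rewrite phiD !phiM phis ab rmorphM /=; ring.
by rewrite phiD !phiM phis; ring.
Qed.

Section QuaternionNucleus.
Variables (F : fieldType) (K : splittingFieldType F) (sigma : gal_of {:K}) (a : K).
Hypotheses (galK : quadratic_galois K) (sigmaP : nontrivial_aut sigma).
Hypothesis aF : a \notin 1%VS.

(** For x = p + q t, comparing (x t) t with x (t t) gives q a = q (sigma a). *)
Lemma quat_left_nucleus (x : quat_alg sigma a) : left_nucleus _ x <-> x.2 = 0.
Proof.
case: x => p q /=; split=> [Hx|->]; last first.
  move=> [y1 y2] [z1 z2]; rewrite /= /quat_mul /= !mul0r !addr0.
  by congr pair; ring.
have /(congr1 snd) := Hx ((0, 1) : K * K)%type ((0, 1) : K * K)%type.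
rewrite /= /quat_mul /= !rmorph0 !rmorph1 !(mul0r, mulr0, mulr1, mul1r, add0r, addr0).
move=> E; apply/eqP; apply: contraR aF => q0.
by apply: (quadratic_fixed galK sigmaP); apply: (mulfI q0); rewrite E.
Qed.

Lemma quat_has_left_nucleus : has_left_nucleus K (quat_alg sigma a).
Proof.
pose f (x : K) : quat_alg sigma a := (x, 0).
have fL : linear f by move=> c x y; rewrite /f; congr pair; rewrite /= scaler0 addr0.
pose fP := GRing.isLinear.Build _ _ _ _ f fL.
exists (HB.pack f fP : {linear K -> quat_alg sigma a}); split=> /=.
- by move=> x y [].
- by move=> x y; rewrite /f /quat_mul /= !(mul0r, mulr0, addr0).
apply/seteqP; split=> [_ [x _ <-]|[x y] /quat_left_nucleus /= ->].
  exact/quat_left_nucleus.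
by exists x.
Qed.

End QuaternionNucleus.

Section QuaternionClassification.
Variables (F : fieldType) (K : splittingFieldType F) (r : K) (c : F).
Hypotheses (two0 : (2%:R : F) != 0) (dimK : \dim {:K} = 2%N).
Hypotheses (rF : r \notin 1%VS) (r2 : r ^+ 2 = c%:A).
Variable sigma : gal_of {:K}.
Hypothesis sigmaP : nontrivial_aut sigma.

Let galK : quadratic_galois K := sqrt_quadratic_galois two0 dimK rF r2.

(** An isomorphism f preserves the left nucleus, so it maps r to a square root
    rho of c in K, that is r or - r. Write f(t) = p + k t: applying f to
    t r = - r t gives 2 p rho = 0, hence p = 0, and t^2 = a gives the norm
    relation. *)
Lemma quat_isomorphic_norm (a b : K) : a \notin 1%VS -> b \notin 1%VS ->
  na_isomorphic (quat_alg sigma a) (quat_alg sigma b) ->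
  exists2 k, k != 0 & a = k * sigma k * b \/ sigma a = k * sigma k * b.
Proof.
move=> aF bF [f [fB fM]].
have fN x : (f (x, 0)).2 = 0.
  apply/(quat_left_nucleus galK sigmaP bF)/(na_iso_left_nucleus fB fM).
  exact/(quat_left_nucleus galK sigmaP aF).
have f1 : f (1, 0) = (1, 0) := na_iso_one fB fM.
case Er: (f (r, 0)) => [rho z]; have z0 : z = 0 by rewrite -(fN r) Er.
rewrite {}z0 in Er.
have fC u v : f (u%:A + v *: r, 0) = (u%:A + v *: rho, 0).
  have -> : (u%:A + v *: r, 0) = u *: (1, 0) + v *: (r, 0) :> (K * K)%type.
    by congr pair; rewrite /= ?scaler0 ?addr0.
  rewrite linearD !linearZ /= f1 Er.
  by congr pair; rewrite /= ?scaler0 ?addr0.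
have rho2 : rho ^+ 2 = c%:A.
  have := fM (r, 0) (r, 0); rewrite /= /quat_mul /= Er /=.
  rewrite !rmorph0 !(mul0r, mulr0, addr0) -!expr2 r2.
  have := fC c 0; rewrite !scale0r !addr0 => -> [] //.
have rho_r : rho = r \/ rho = - r.
  by move/eqP: rho2; rewrite -r2 eqf_sqr => /orP[] /eqP; [left|right].
have rho0 : rho != 0.
  apply: contra rF => /eqP rho0; case: rho_r; rewrite rho0.
    by move=> <-; rewrite mem0v.
  by move/eqP; rewrite eq_sym oppr_eq0 => /eqP ->; rewrite mem0v.
case Et: (f (0, 1)) => [p k].
have p0 : p = 0.
  have := fM (0, 1) (r, 0); have := fM (- r, 0) (0, 1).
  rewrite /= /quat_mul /= !rmorph0 !rmorph1 (aut_sqrt dimK rF r2 sigmaP).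
  rewrite !(mul0r, mulr0, mulr1, mul1r, addr0, add0r) => -> E.
  have fNr : f (- r, 0) = (- rho, 0).
    by have := fC 0 (-1); rewrite !scale0r !add0r !scaleN1r.
  move: E; rewrite Er Et fNr /= !rmorph0 !(mul0r, mulr0, addr0) => -[E _].
  have /eqP : (2%:R : F) *: (p * rho) = 0.
    by rewrite scaler_nat mulr2n -{1}E mulNr [rho * p]mulrC addNr.
  by rewrite scaler_eq0 (negPf two0) mulf_eq0 (negPf rho0) orbF => /eqP.
rewrite {}p0 in Et.
exists k.
  apply/eqP => k0; have /bij_inj fI := fB.
  have : f (0, 1) = f 0 by rewrite Et k0 linear0.
  by move/fI => [] /eqP; rewrite oner_eq0.
have [u [v aE]] := quadratic_coord dimK rF a.
have := fM (0, 1) (0, 1); rewrite /= /quat_mul /= Et /=.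
rewrite !rmorph0 rmorph1 !(mul0r, mulr0, mulr1, mul1r, addr0, add0r).
rewrite aE fC => -[E].
case: rho_r => rhoE; move: E; rewrite rhoE => <-; [by left | right].
by rewrite (aut_coord dimK rF r2 sigmaP) scalerN.
Qed.

Lemma quat_isomorphic_coord (x y x' y' : F) : y != 0 -> y' != 0 ->
  na_isomorphic (quat_alg sigma (x%:A + y *: r)) (quat_alg sigma (x'%:A + y' *: r))
  <-> exists m, [/\ m != 0, norm_value c m, x = m * x' & y = m * y' \/ y = - (m * y')].
Proof.
move=> y0 y'0.
have mulA m : m%:A * (x'%:A + y' *: r) = (m * x')%:A + (m * y') *: r.
  by rewrite mulr_algl scalerDr !scalerA.
split=> [/quat_isomorphic_norm|[m [m0 [p [q mE]] xE yE]]].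
  rewrite !(quadratic_coord_in1 rF) => /(_ y0 y'0)[k k0].
  have [p [q kE]] := quadratic_coord dimK rF k.
  rewrite (aut_coord dimK rF r2 sigmaP) kE.
  rewrite (mul_aut_coord dimK rF r2 sigmaP) mulA => E.
  exists (p ^+ 2 - c * q ^+ 2).
  have inj := quadratic_coord_inj rF.
  have [Ex Ey] : x = (p ^+ 2 - c * q ^+ 2) * x' /\ (y = (p ^+ 2 - c * q ^+ 2) * y'
      \/ y = - ((p ^+ 2 - c * q ^+ 2) * y')).
    case: E => [/inj[-> ->]|]; first by split; [|left].
    by rewrite -scaleNr => /inj[-> <-]; split; [|right; rewrite opprK].
  split=> //; last by exists p, q.
  by apply: contraNneq y0 => m0; case: Ey => ->; rewrite m0 mul0r ?oppr0.
pose k := p%:A + q *: r.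
have kN : k * sigma k = m%:A by rewrite (mul_aut_coord dimK rF r2 sigmaP) mE.
have k0 : k != 0.
  apply: contraNneq m0 => k0; move/eqP: kN.
  by rewrite k0 mul0r eq_sym scaler_eq0 oner_eq0 orbF.
case: yE => yE.
  apply: (@quat_isomorphicI _ _ _ _ _ id _ _ k) => //; first by exists id.
  by rewrite kN mulA -xE -yE.
apply: (@quat_isomorphicI _ _ _ _ _ sigma _ _ k) => //.
- by move=> a u v; rewrite linearP.
- exists sigma => z; have [u [v ->]] := quadratic_coord dimK rF z;
    by rewrite (aut_coord dimK rF r2 sigmaP) -scaleNr
      (aut_coord dimK rF r2 sigmaP) scaleNr opprK.
- by move=> u v; rewrite rmorphM.
by rewrite kN mulA (aut_coord dimK rF r2 sigmaP) -xE yE scaleNr opprK.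
Qed.

(** The left nucleus determines the quadratic extension: an isomorphism of K
    onto the left nucleus L carries a square root onto a square root, hence
    the nontrivial automorphism onto the nontrivial automorphism. *)
Lemma na_quaternion_over (A : naAlgebra F) :
  is_na_quaternion A -> has_left_nucleus K A ->
  exists2 a : K, a \notin 1%VS & na_isomorphic A (quat_alg sigma a).
Proof.
case=> [L [sL [aL [galL sLP aLF Aiso]]]] [f [fI fM frange]].
have [g [gB gM]] := Aiso.
have gN := na_iso_left_nucleus gB gM.
have quatN := quat_left_nucleus galL sLP aLF.
have fN x : left_nucleus A (f x) by rewrite -frange; exists x.
pose psi x := (g (f x)).1.
have psiE x : g (f x) = (psi x, 0).
  by have /gN/quatN := fN x; rewrite /psi; case: (g _) => ? ? /= ->.
have psiL : linear psi by move=> u x y; rewrite /psi !linearP.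
have psiM x y : psi (x * y) = psi x * psi y.
  rewrite {1}/psi fM gM !psiE /= /quat_mul /= rmorph0.
  by rewrite !(mul0r, mulr0, addr0).
have psiI : injective psi.
  by move=> x y E; apply/fI/(bij_inj gB); rewrite !psiE E.
have psiS y : exists x, psi x = y.
  have [g' gK g'K] := gB.
  have : left_nucleus A (g' (y, 0)) by apply/gN/quatN; rewrite g'K.
  by rewrite -frange => -[x _ fx]; exists x; rewrite /psi fx g'K.
have [phi phiP] := choice psiS.
have psi1 : psi 1 = 1.
  by have [x x1] := psiS 1; rewrite -[LHS]mulr1 -x1 -psiM mul1r.
have psi0 : psi 0 = 0.
  by have := psiL (-1) 0 0; rewrite scaler0 addr0 scaleN1r addNr.
have psiC u v x : psi (u%:A + v *: x) = u%:A + v *: psi x.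
  by rewrite psiL psi1 -[v *: x]addr0 psiL psi0 addr0.
have psi_in1 x : psi x \in 1%VS -> x \in 1%VS.
  case/vlineP=> w E; have : psi x = psi (w%:A + 0 *: x) by rewrite psiC scale0r addr0.
  by move/psiI ->; rewrite scale0r addr0 rpredZ ?mem1v.
have sL_psi x : sL (psi x) = psi (sigma x).
  have [u [v ->]] := quadratic_coord dimK rF x.
  rewrite (aut_coord dimK rF r2 sigmaP) -scaleNr !psiC linearD !linearZ /= rmorph1.
  suff -> : sL (psi r) = - psi r by rewrite scalerN scaleNr.
  have : sL (psi r) ^+ 2 = psi r ^+ 2.
    have E : psi r ^+ 2 = c%:A.
      by rewrite expr2 -psiM -expr2 r2; have := psiC c 0 0; rewrite !scale0r !addr0.
    by rewrite -rmorphXn /= E linearZ /= rmorph1.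
  move/eqP; rewrite eqf_sqr => /orP[/eqP E|/eqP //].
  by case/negP: rF; apply/psi_in1/(quadratic_fixed galL sLP).
exists (phi aL).
  by apply: contra aLF => /vlineP[w E]; rewrite -(phiP aL) E -[w%:A]addr0
    -(scale0r 0) psiC scale0r addr0 rpredZ ?mem1v.
apply: na_isomorphic_trans Aiso _.
apply: (@quat_isomorphicI _ _ _ _ _ phi _ _ 1) => //.
- by move=> u x y; apply: psiI; rewrite psiL !phiP.
- by exists psi => x; [rewrite phiP | apply: psiI; rewrite phiP].
- by move=> x y; apply: psiI; rewrite psiM !phiP.
- by move=> x; apply: psiI; rewrite -sL_psi !phiP.
- exact: oner_neq0.
by rewrite rmorph1 !mul1r.
Qed.

(** A quaternion algebra is given by x + y r with y nonzero, up to scaling by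
    norms and to the sign of y. For x nonzero the scaling brings x to 1 or n,
    and leaves only the sign of y free because the remaining norm must be 1;
    for x = 0 it is y that is scaled, to an element of S0. *)
Lemma represents_once_coord (n : F) (R S0 : set F) (S : set K) :
  norm_index2 c n ->
  (forall s, R s -> s != 0) ->
  (forall x, x != 0 -> exists! s, R s /\ (s = x \/ s = - x)) ->
  (forall s, S0 s -> s != 0) ->
  (forall y, y != 0 -> exists! s, S0 s /\ (norm_value c (y / s) \/ norm_value c (- y / s))) ->
  (forall a, S a <-> (exists2 s, S0 s & a = s *: r)
      \/ (exists2 s, R s & a = 1 + s *: r \/ a = n%:A + s *: r)) ->
  represents_once sigma S.
Proof.
move=> [n0 nN Nn] R0 Rrep S00 S0rep SE.
have coordS a : S a -> exists x y, [/\ a = x%:A + y *: r, y != 0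
    & (x = 0 /\ S0 y) \/ ((x = 1 \/ x = n) /\ R y)].
  case/SE => [[s Ss ->]|[s Rs [->|->]]].
  - by exists 0, s; split; [rewrite scale0r add0r | exact: S00 | left].
  - by exists 1, s; split; [rewrite scale1r | exact: R0 | right; split; [left|]].
  - by exists n, s; split; [ | exact: R0 | right; split; [right|]].
have coordI x y : (x = 0 /\ S0 y) \/ ((x = 1 \/ x = n) /\ R y) -> S (x%:A + y *: r).
  move=> xy; apply/SE; case: xy => [[-> Sy]|[[->|->] Ry]].
  - by left; exists y; rewrite // scale0r add0r.
  - by right; exists y => //; left; rewrite scale1r.
  - by right; exists y => //; right.
have notF x y : y != 0 -> x%:A + y *: r \notin 1%VS by rewrite (quadratic_coord_in1 rF).
split=> [a /coordS[x [y [-> y0 _]]]|A Aq AK].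
  by split; [exact: notF | apply: quat_has_left_nucleus => //; exact: notF].
have [b bF Ab] := na_quaternion_over Aq AK.
have [x [y bE]] := quadratic_coord dimK rF b.
have y0 : y != 0 by move: bF; rewrite bE (quadratic_coord_in1 rF).
rewrite {}bE in Ab {bF}.
(* it remains to find the pair of coordinates (x', y'), a question about F *)
pose P x' y' := [/\ y' != 0, (x' = 0 /\ S0 y') \/ ((x' = 1 \/ x' = n) /\ R y')
   & exists m, [/\ m != 0, norm_value c m, x = m * x' & y = m * y' \/ y = - (m * y')]].
suff [x' [y' [P' Puniq]]] : exists x' y',
    P x' y' /\ forall x'' y'', P x'' y'' -> x' = x'' /\ y' = y''.
  case: (P') => y'0 xy' m'; exists (x'%:A + y' *: r); split.
    split; first exact: coordI.
    by apply: na_isomorphic_trans Ab _; apply/quat_isomorphic_coord.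
  move=> a [/coordS[x'' [y'' [-> y''0 xy'']]] Aa].
  have [|-> -> //] := Puniq x'' y''; split=> //.
  apply/quat_isomorphic_coord => //.
  exact: na_isomorphic_trans (na_isomorphic_sym Ab) Aa.
have [x0|x0] := eqVneq x 0.
  have [y' [[Sy' Ny'] y'uniq]] := S0rep y y0.
  have y'0 := S00 y' Sy'.
  exists 0, y'; split.
    split=> //; first by left.
    case: Ny' => Ny'; eexists; (split; [| exact: Ny' | by rewrite mulr0 |]).
    - by rewrite mulf_neq0 ?invr_eq0.
    - by left; rewrite divfK.
    - by rewrite mulf_neq0 ?oppr_eq0 ?invr_eq0.
    - by right; rewrite divfK // opprK.
  move=> x'' y'' [y''0 xy'' [m [m0 Nm xE yE]]].
  have x''0 : x'' = 0.
    by apply/eqP; move/eqP: xE; rewrite x0 eq_sym mulf_eq0 (negPf m0).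
  case: xy'' => [[_ Sy'']|[[x1|xn] _]].
  - split=> //; apply: y'uniq; split=> //.
    by case: yE => ->; [left | right]; rewrite ?opprK mulfK.
  - by have := oner_neq0 F; rewrite -x1 x''0 eqxx.
  - by case/eqP: n0; rewrite -xn.
(* the class of x modulo norms selects x', and then m = x / x' *)
have [x' [x'1n Nx']] : exists x', (x' = 1 \/ x' = n) /\ norm_value c (x / x').
  case: (Nn x x0) => Nx; last by exists n; split; [right|].
  by exists 1; rewrite divr1; split; [left|].
have x'0 : x' != 0 by case: x'1n => ->; rewrite ?oner_neq0.
have m0 : x / x' != 0 by rewrite mulf_neq0 ?invr_eq0.
have [y' [[Ry' y'E] y'uniq]] := Rrep (y / (x / x')) (mulf_neq0 y0 (invr_neq0 m0)).
exists x', y'; split.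
  split; [exact: R0 | by right | exists (x / x'); split=> //].
    by rewrite divfK.
  by case: y'E => ->; [left | right]; rewrite ?mulrN ?opprK mulrC divfK.
move=> x'' y'' [y''0 xy'' [m [m'0 Nm xE yE]]].
case: xy'' => [[x''0 _]|[x''1n Ry'']].
  by case/eqP: x0; rewrite xE x''0 mulr0.
(* the ratio of x' and x'' is a norm, and n is not *)
have xx : x' = x''.
  have E : x'' / x' = (x / x') / m by rewrite xE; field; apply/andP.
  have N1 : norm_value c (x'' / x') by rewrite E; apply: norm_value_div.
  have N2 : norm_value c (x' / x'') by rewrite -invf_div; apply: norm_valueV.
  by case: x'1n N1 N2 => ->; case: x''1n => -> //; rewrite !divr1.
split=> //; apply: y'uniq; split=> //.
have -> : x / x' = m by rewrite xE -xx mulfK.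
by case: yE => ->; [left | right]; rewrite ?mulNr ?opprK mulrC mulKf.
Qed.

End QuaternionClassification.

(** * Integers and ramification *)

Lemma Q2_integral_or_inverse (q : Q2) :
  (exists z, q = tofrac z) \/ (exists z, q * tofrac (2%:R * z) = 1).
Proof.
have [x [y [y0 ->]]] := fraction_quotient q.
have [->|x0] := eqVneq x 0; first by left; exists 0; rewrite rmorph0 mul0r.
have [k [u xE]] := Z2_pow2_odd x0; have [l [v yE]] := Z2_pow2_odd y0.
have [u' uu'] := Z2_odd_unit u; have [v' vv'] := Z2_odd_unit v.
have y0' : tofrac y != 0 by rewrite tofrac_eq0.
have [lk|kl] := leqP l k.
  left; exists (2%:R ^+ (k - l) * (1 + 2%:R * u) * v').
  apply: (canLR (mulfK y0')); rewrite -rmorphM; congr (tofrac _).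
  rewrite xE yE -[in LHS](subnKC lk) exprD -[LHS]mulr1 -[X in _ * X]vv'; ring.
right; exists (2%:R ^+ (l - k.+1) * (1 + 2%:R * v) * u').
apply: (mulIf y0'); rewrite mul1r mulrAC divfK // -rmorphM; congr (tofrac _).
rewrite xE yE -[in RHS](subnKC kl) exprD exprS -[RHS]mulr1 -[X in _ = _ * X]uu'; ring.
Qed.

(** If q = 1 / (2 z), clearing denominators in a monic equation for q gives
    1 + 2 y = 0. *)
Lemma Z2_integrally_closed (p : {poly Z2}) (q : Q2) :
  p \is monic -> root (map_poly (@tofrac Z2) p) q -> exists z, q = tofrac z.
Proof.
move=> p1 /rootP pq; have [//|[z qz]] := Q2_integral_or_inverse q.
exfalso; pose w := 2%:R * z; pose d := (size p).-1.
have sp : size p = d.+1 by rewrite prednK // lt0n size_poly_eq0 monic_neq0.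
have E : \sum_(i < d.+1) p`_i * w ^+ (d - i) = 0.
  apply/eqP; rewrite -tofrac_eq0 rmorph_sum /=; apply/eqP.
  transitivity ((map_poly (@tofrac Z2) p).[q] * tofrac w ^+ d); last by rewrite pq mul0r.
  have sfp : (size (map_poly (@tofrac Z2) p) <= d.+1)%N.
    by rewrite -sp; apply: size_poly.
  rewrite (horner_coef_wide _ sfp) mulr_suml; apply: eq_bigr => i _ /=.
  rewrite coef_map rmorphM rmorphXn /= -mulrA; congr (_ * _).
  have led : (i <= d)%N by rewrite -ltnS.
  have -> : tofrac w ^+ d = tofrac w ^+ i * tofrac w ^+ (d - i).
    by rewrite -exprD subnKC.
  by rewrite mulrA -exprMn qz expr1n mul1r.
move: E; rewrite big_ord_recr /= subnn mulr1.
have -> : p`_d = 1 by rewrite -(monicP p1).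
have [y ->] : exists y, \sum_(i < d) p`_i * w ^+ (d - i) = 2%:R * y.
  exists (\sum_(i < d) p`_i * (z * w ^+ (d - i.+1))).
  rewrite mulr_sumr; apply: eq_bigr => i _ /=.
  by rewrite -[(d - i)%N]prednK ?subn_gt0 // -subnS exprS {1}/w; ring.
by rewrite addrC => E; apply: (@Z2_odd_neq_even y 0); rewrite E mulr0.
Qed.

Lemma Q2_sqr_integral (q : Q2) (z : Z2) : q ^+ 2 = tofrac z -> exists w, q = tofrac w.
Proof.
move=> qz; apply: (@Z2_integrally_closed ('X^2 - z%:P)); first exact: monicXnsubC.
by rewrite /root rmorphB /= map_polyXn map_polyC /= !hornerE qz subrr.
Qed.

Lemma Z2_2_not_unit (y z : Z2) : 2%:R * y * z <> 1.
Proof.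
move=> E; apply: (@Z2_odd_neq_even 0 (y * z)).
by rewrite mulr0 addr0 mulrA E.
Qed.

Lemma int_ring_quadratic (K : fieldExtType Q2) (x : K) (t n : Z2) :
  x ^+ 2 = (tofrac t)%:A * x - (tofrac n)%:A -> int_ring x.
Proof.
move=> xE; have sP : Poly [:: n; - t; 1] = [:: n; - t; 1] :> seq Z2.
  by rewrite (@PolyK _ 0) //= oner_neq0.
exists (Poly [:: n; - t; 1]).
  by rewrite monicE lead_coefE sP.
rewrite /root map_polyE sP horner_Poly /=.
rewrite mul0r add0r rmorphN rmorph1 /= scale1r scaleNr mulrDl mul1r -expr2 xE.
by rewrite mulNr; apply/eqP; ring.
Qed.

Section Integers.
Variables (K : splittingFieldType Q2).

Let iota : {rmorphism Z2 -> K} := in_alg K \o @tofrac Z2.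

Lemma int_ring_base (q : Q2) : int_ring (q%:A : K) -> exists z, q = tofrac z.
Proof.
case=> p p1 pq; apply: (Z2_integrally_closed p1).
have : root (map_poly (in_alg K) (map_poly (@tofrac Z2) p)) (in_alg K q).
  by rewrite -map_poly_comp.
by rewrite fmorph_root.
Qed.

Lemma int_ring_aut (sigma : gal_of {:K}) (x : K) : int_ring x -> int_ring (sigma x).
Proof.
case=> p p1 px; exists p => //.
have <- : map_poly sigma (map_poly iota p) = map_poly iota p.
  by rewrite -map_poly_comp; apply: eq_map_poly => z /=; rewrite linearZ /= rmorph1.
exact: rmorph_root px.
Qed.

Lemma int_ringM (x y : K) : int_ring x -> int_ring y -> int_ring (x * y).
Proof. exact: (@integral_mul _ _ iota). Qed.

Lemma int_ringD (x y : K) : int_ring x -> int_ring y -> int_ring (x + y).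
Proof. exact: (@integral_add _ _ iota). Qed.

Lemma int_ring_Z2 (z : Z2) : int_ring ((tofrac z)%:A : K).
Proof. exact: (integral_id iota). Qed.

Lemma Z2_alg_inj (y z : Z2) : (tofrac y)%:A = (tofrac z)%:A :> K -> y = z.
Proof. by move/(fmorph_inj (in_alg K))/eqP; rewrite tofrac_eq => /eqP. Qed.

Lemma Z2_algM (y z : Z2) : (tofrac (y * z))%:A = (tofrac y)%:A * (tofrac z)%:A :> K.
Proof. exact: (rmorphM iota). Qed.

Lemma Z2_alg1 : (tofrac 1)%:A = 1 :> K.
Proof. exact: (rmorph1 iota). Qed.

Lemma Z2_alg_nat n : (tofrac n%:R)%:A = n%:R :> K.
Proof. exact: (rmorph_nat iota n). Qed.

Lemma ext_two_neq0 : (2%:R : K) != 0.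
Proof.
apply/eqP => E; have /eqP : (2%:R : Z2) = 0.
  by apply: Z2_alg_inj; rewrite Z2_alg_nat E; apply/esym/(rmorph0 iota).
by rewrite pmulrn Z2_int_eq0.
Qed.

Variables (r : K) (c : Q2).
Hypotheses (dimK : \dim {:K} = 2%N) (rF : r \notin 1%VS) (r2 : r ^+ 2 = c%:A).
Variable sigma : gal_of {:K}.
Hypothesis sigmaP : nontrivial_aut sigma.

(** The norm of an integral element is integral and lies in Q_2. *)
Lemma int_ring_norm (x : K) : int_ring x -> exists n, x * sigma x = (tofrac n)%:A.
Proof.
move=> xI; have := int_ringM xI (int_ring_aut sigma xI).
have [u [v ->]] := quadratic_coord dimK rF x.
rewrite (mul_aut_coord dimK rF r2 sigmaP) => /int_ring_base[n ->].
by exists n.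
Qed.

(** A prime element: its norm generates 2 Z_2, so it is a nonunit that 2 does
    not divide. *)
Lemma ramified_of_uniformizer (x : K) (m : Z2) : int_ring x ->
  x * sigma x = (tofrac (2%:R * (1 + 2%:R * m)))%:A -> ~ unramified K.
Proof.
move=> xI xN unr; have : max_ideal x.
  split=> // -[x0 /int_ring_norm[n xVN]].
  apply: (@Z2_2_not_unit (1 + 2%:R * m) n); apply: Z2_alg_inj.
  by rewrite Z2_algM -xN -xVN Z2_alg1 mulrACA -rmorphM divff // rmorph1 mul1r.
rewrite -unr => -[y yI yx]; have [n yN] := int_ring_norm yI.
apply: (@Z2_odd_neq_even m n); apply: Z2_alg_inj.
apply: (mulfI ext_two_neq0); rewrite -{1}Z2_alg_nat -Z2_algM -xN -yx.
by rewrite Z2_algM Z2_alg_nat rmorphM rmorph_nat -yN; ring.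
Qed.

(** An integral y = (t + w r) / 2 with r^2 = -3 and norm 2 m satisfies the
    hypothesis, and then y / 2 = (t' + w' r) / 2 has integral norm n. Indeed
    t^2 + 3 w^2 is 4 modulo 8 when t and w are odd, and t, w (then also t', w')
    have the same parity because the sum of squares is even. *)
Lemma Z2_trace_norm_even (t w m : Z2) : t ^+ 2 + 3%:R * w ^+ 2 = 8%:R * m ->
  exists t' w' n, [/\ t = 2%:R * t', w = 2%:R * w' & t' ^+ 2 + 3%:R * w' ^+ 2 = 4%:R * n].
Proof.
have even_consec (z : Z2) : exists e, z + z ^+ 2 = 2%:R * e.
  have [y [->|->]] := Z2_parity z; first by exists (y + 2%:R * y ^+ 2); ring.
  by exists (1 + 3%:R * y + 2%:R * y ^+ 2); ring.
have can2 (y z : Z2) : 2%:R * y = 2%:R * z -> y = z.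
  by apply: mulfI; rewrite pmulrn Z2_int_eq0.
have no_odd (y z : Z2) : 1 + 2%:R * y = 2%:R * z -> False := @Z2_odd_neq_even y z.
have [t' [->|->]] := Z2_parity t; have [w' [->|->]] := Z2_parity w => E.
- have {E} : t' ^+ 2 + 3%:R * w' ^+ 2 = 2%:R * m.
    by apply/can2/can2; transitivity (8%:R * m); [rewrite -E; ring | ring].
  have [p [->|->]] := Z2_parity t'; have [q [->|->]] := Z2_parity w' => E.
  + by exists (2%:R * p), (2%:R * q), (p ^+ 2 + 3%:R * q ^+ 2); split=> //; ring.
  + by case: (no_odd (1 + 2%:R * p ^+ 2 + 6%:R * q + 6%:R * q ^+ 2) m); rewrite -E; ring.
  + by case: (no_odd (2%:R * p + 2%:R * p ^+ 2 + 6%:R * q ^+ 2) m); rewrite -E; ring.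
  + exists (1 + 2%:R * p), (1 + 2%:R * q), (1 + p + p ^+ 2 + 3%:R * q + 3%:R * q ^+ 2).
    by split=> //; ring.
- by case: (no_odd (1 + 2%:R * t' ^+ 2 + 6%:R * w' + 6%:R * w' ^+ 2) (4%:R * m));
    (transitivity (8%:R * m); [rewrite -E; ring | ring]).
- by case: (no_odd (2%:R * t' + 2%:R * t' ^+ 2 + 6%:R * w' ^+ 2) (4%:R * m));
    (transitivity (8%:R * m); [rewrite -E; ring | ring]).
have [e eE] := even_consec t'; have [f fE] := even_consec w'.
case: (no_odd (e + 3%:R * f) m); apply/can2/can2.
transitivity (8%:R * m); last by ring.
rewrite -E; transitivity (4%:R + 4%:R * (2%:R * e) + 12%:R * (2%:R * f)); first by ring.
by rewrite -eE -fE; ring.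
Qed.

Lemma unramified_sqrtN3 : c = - 3%:R -> unramified K.
Proof.
move=> c3; apply/seteqP; split=> [_ [x xI <-]|y [yI yU]].
  split; first by apply: int_ringM => //; rewrite -Z2_alg_nat; apply: int_ring_Z2.
  (* N(2 x) N(1 / (2 x)) = 1 is impossible, 4 N(x) being even *)
  move=> [x20 /int_ring_norm[q qE]]; have [n nE] := int_ring_norm xI.
  have E1 : 2%:R * x * (2%:R * x)^-1 = 1 := mulfV x20.
  move: (2%:R * x)^-1 E1 qE => z E1 qE.
  have E2 : 2%:R * sigma x * sigma z = 1.
    by rewrite -(rmorph_nat sigma 2) -!rmorphM E1 rmorph1.
  apply: (@Z2_2_not_unit (2%:R * n) q); apply: Z2_alg_inj.
  rewrite !Z2_algM Z2_alg1 Z2_alg_nat -nE -qE.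
  transitivity (2%:R * x * z * (2%:R * sigma x * sigma z)); first by ring.
  by rewrite E1 E2 mulr1.
have sigI := int_ring_aut sigma yI.
have [n nE] := int_ring_norm yI; have [n' [nn'|nn']] := Z2_parity n; last first.
  (* an odd norm makes y a unit, with inverse sigma y / n *)
  have [k kE] := Z2_odd_unit n'.
  have yV : y * ((tofrac k)%:A * sigma y) = 1 by rewrite mulrCA nE nn' -Z2_algM mulrC kE Z2_alg1.
  have y0 : y != 0 by apply: contra_eq_neq yV => ->; rewrite mul0r eq_sym oner_eq0.
  case: yU; split=> //; rewrite -[y^-1]mulr1 -yV mulKf //.
  by apply: int_ringM => //; apply: int_ring_Z2.
(* otherwise y = (t + w r) / 2 with t and w in Z_2, to be divided by 2 *)
have [u [v yE]] := quadratic_coord dimK rF y.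
have [t tE] : exists t, 2%:R * u = tofrac t.
  apply: int_ring_base; suff -> : (2%:R * u)%:A = y + sigma y by apply: int_ringD.
  rewrite yE (aut_coord dimK rF r2 sigmaP) addrACA subrr addr0 -mulr2n.
  by rewrite -scaler_nat scalerA.
have normE : u ^+ 2 + 3%:R * v ^+ 2 = tofrac (2%:R * n').
  apply: (fmorph_inj (in_alg K)); rewrite /= -nn' -nE yE (mul_aut_coord dimK rF r2 sigmaP).
  by rewrite c3 mulNr opprK.
(* 3 w^2 = 8 n' - t^2 is integral, hence so is w *)
have [w wE] : exists w, 2%:R * v = tofrac w.
  have [k kE] := Z2_odd_unit 1.
  have k3 : tofrac k * 3%:R = 1.
    have E3 : (3%:R : Z2) = 1 + 2%:R * 1 by rewrite mulr1 -mulrS.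
    by rewrite -(rmorph_nat (@tofrac Z2)) -rmorphM mulrC E3 kE rmorph1.
  apply: (@Q2_sqr_integral _ (k * (8%:R * n' - t ^+ 2))).
  rewrite rmorphM rmorphB rmorphM rmorphXn /= -tE.
  transitivity (tofrac k * 3%:R * (2%:R * v) ^+ 2); first by rewrite k3 mul1r.
  rewrite -mulrA; congr (_ * _).
  have clear_norm (F : fieldType) (a b d : F) : a ^+ 2 + 3%:R * b ^+ 2 = d ->
    3%:R * (2%:R * b) ^+ 2 = 4%:R * d - (2%:R * a) ^+ 2 by move=> <-; ring.
  rewrite (clear_norm _ _ _ _ normE) rmorphM; congr (_ - _).
  by rewrite !rmorph_nat mulrA -natrM.
have twE : t ^+ 2 + 3%:R * w ^+ 2 = 8%:R * n'.
  apply/eqP; rewrite -tofrac_eq; apply/eqP.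
  rewrite rmorphD !expr2 !rmorphM /= -tE -wE !rmorph_nat -!expr2.
  have clear_norm (F : fieldType) (a b d : F) : a ^+ 2 + 3%:R * b ^+ 2 = 2%:R * d ->
    (2%:R * a) ^+ 2 + 3%:R * (2%:R * b) ^+ 2 = 8%:R * d.
    move=> E; transitivity (4%:R * (a ^+ 2 + 3%:R * b ^+ 2)); first by ring.
    by rewrite E; ring.
  by apply: clear_norm; rewrite normE rmorphM rmorph_nat.
have [t' [w' [m [tt' ww' mE]]]] := Z2_trace_norm_even twE.
have y2 : 2%:R * y = (tofrac t)%:A + (tofrac w)%:A * r.
  by rewrite mulr_natl -scaler_nat yE scalerDr !scalerA tE wE mulr_algl.
pose x := (2%:R : K)^-1 * y.
have yx : y = 2%:R * x by rewrite mulVKf // ext_two_neq0.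
have x2 : 2%:R * x = (tofrac t')%:A + (tofrac w')%:A * r.
  by apply: (mulfI ext_two_neq0); rewrite -yx y2 tt' ww' !Z2_algM Z2_alg_nat; ring.
exists x => //; apply: (@int_ring_quadratic _ _ t' m).
have four0 : (4%:R : K) != 0 by rewrite (natrM _ 2 2) mulf_neq0 ?ext_two_neq0.
apply: (mulfI four0).
transitivity ((2%:R * x) ^+ 2); first by ring.
have {}mE : (tofrac t')%:A ^+ 2 + 3%:R * (tofrac w')%:A ^+ 2 = 4%:R * (tofrac m)%:A :> K.
  by rewrite !expr2 -!Z2_alg_nat -!Z2_algM -mE; apply/esym/(rmorphD iota).
transitivity (2%:R * (tofrac t')%:A * (2%:R * x) - 4%:R * (tofrac m)%:A); last by ring.
have r3 : r ^+ 2 = - 3%:R by rewrite r2 c3 scaleNr scaler_nat.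
by rewrite -mE x2 sqrrD exprMn r3; ring.
Qed.

End Integers.

(** * Representatives of y modulo norms and sign *)

Section SignNormReps.
Variables (F : fieldType) (c : F).
Local Open Scope classical_set_scope.

Lemma sign_norm_reps_pair (n : F) : norm_index2 c n -> norm_value c (-1) ->
  forall y, y != 0 -> exists! s,
    [set 1; n] s /\ (norm_value c (y / s) \/ norm_value c (- y / s)).
Proof.
move=> [n0 nN Nn] N1 y y0.
have opp s : norm_value c (- y / s) -> norm_value c (y / s).
  by move/(norm_valueM N1); rewrite mulN1r mulNr opprK.
have Nyn : norm_value c y -> norm_value c (y / n) -> False.
  move=> Ny Nyn; apply: nN; have := norm_value_div Ny Nyn.
  by rewrite invf_div mulrCA mulfV ?mulr1.
case: (Nn y y0) => Ny; [exists 1 | exists n]; split.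
- by split; [left | left; rewrite divr1].
- by move=> s [[->//|->] [|/opp]] /(Nyn Ny).
- by split; [right | left].
- by move=> s [[->|->//] [|/opp]]; rewrite divr1 => /Nyn/(_ Ny).
Qed.

Lemma sign_norm_reps_single : norm_index2 c (-1) ->
  forall y, y != 0 -> exists! s,
    [set 1] s /\ (norm_value c (y / s) \/ norm_value c (- y / s)).
Proof.
move=> [_ _ Nn] y y0; exists 1; split=> [|s [-> _]//]; split=> //.
by case: (Nn y y0); rewrite ?invrN1 ?mulrN1 divr1; [left | right; rewrite divr1].
Qed.

End SignNormReps.

(** * The seven quadratic extensions of Q_2 *)

Definition quadratic_radicands : seq int := [:: -3; -6; 2; -1; -2; 3; 6].

Lemma radicand_rep c : c \in quadratic_radicands -> c \in square_class_reps.
Proof. by move: c; apply/allP. Qed.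

Lemma radicand_neq1 c : c \in quadratic_radicands -> c != 1.
Proof. by apply: contraL => /eqP ->. Qed.

Lemma radicand_nonsquare c (w : Q2) : c \in quadratic_radicands -> w ^+ 2 <> c%:~R.
Proof.
move=> cl E; case/eqP: (radicand_neq1 cl).
apply: (@square_class_reps_inj c 1 1 w) (radicand_rep cl) _ (oner_neq0 _) _ => //.
by rewrite expr1n mulr1 mul1r E.
Qed.

Section SqrtExt.
Variables (K : fieldExtType Q2) (r : K) (c : int).
Hypotheses (cl : c \in quadratic_radicands) (rP : is_sqrt_ext c r).

Lemma sqrt_ext_sqr : r ^+ 2 = (c%:~R : Q2)%:A.
Proof. by rewrite rP.1; apply/esym/(rmorph_int (in_alg K)). Qed.

Lemma sqrt_ext_notin1 : r \notin 1%VS.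
Proof.
apply/negP => /vlineP[w rw]; apply: (@radicand_nonsquare c w) => //.
apply: (fmorph_inj (in_alg K)); rewrite rmorphXn /= -rw.
exact: sqrt_ext_sqr.
Qed.

Lemma sqrt_ext_dim2 : \dim {:K} = 2%N.
Proof. exact: sqrt_ext_dim sqrt_ext_sqr sqrt_ext_notin1 rP.2. Qed.

End SqrtExt.

Lemma Q2_two_neq0 : (2%:R : Q2) != 0.
Proof. by rewrite Q2_nat_eq0. Qed.

Lemma sqrt_ext_exists c : c \in quadratic_radicands ->
  exists (K : splittingFieldType Q2) (r : K), quadratic_galois K /\ is_sqrt_ext c r.
Proof.
move=> cl; pose p : {poly Q2} := 'X^2 - (c%:~R)%:P.
have sp : size p = 3%N by rewrite size_XnsubC.
have irr : irreducible_poly p.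
  apply: cubic_irreducible; first by rewrite sp.
  move=> w; apply/negP; rewrite /root !hornerE subr_eq0 => /eqP.
  exact: radicand_nonsquare.
have [L dimL [r pr rL]] := irredp_FAdjoin irr.
have r2 : r ^+ 2 = (c%:~R : Q2)%:A.
  move: pr; rewrite /root rmorphB /= map_polyXn map_polyC /= !hornerE subr_eq0.
  by move/eqP.
have [pF pS] := splitting_poly_sqrt r2 rL.
have spl : SplittingField.axiom L by eexists; [exact: pF | exact: pS].
pose splP := FieldExt_isSplittingField.Build Q2 L spl.
pose K : splittingFieldType Q2 := HB.pack (FieldExt.sort L) splP.
have rP : @is_sqrt_ext c K r.
  by split=> //; rewrite r2; apply: (rmorph_int (in_alg L)).
exists K, r; split=> //.
apply: (sqrt_quadratic_galois Q2_two_neq0 _ (sqrt_ext_notin1 cl rP) r2).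
exact: sqrt_ext_dim2 rP.
Qed.

(** The image u + v s of a square root of c satisfies 2 u v = 0, so that c is
    either the square u^2 or d v^2. *)
Lemma sqrt_ext_iso_eq (c d : int) (K L : fieldExtType Q2) (r : K) (s : L) :
  c \in quadratic_radicands -> d \in quadratic_radicands ->
  is_sqrt_ext c r -> is_sqrt_ext d s -> ext_isomorphic K L -> c = d.
Proof.
move=> cl dl rP sP [f _].
have dimL := sqrt_ext_dim2 dl sP; have sF := sqrt_ext_notin1 dl sP.
have [u [v fr]] := quadratic_coord dimL sF (f r).
have := quadratic_coord_inj sF (u := u ^+ 2 + d%:~R * v ^+ 2) (v := u * v *+ 2)
  (u' := c%:~R) (v' := 0).
case.
  rewrite scale0r addr0 -[RHS](rmorph_alg f) -(sqrt_ext_sqr rP) rmorphXn /= fr.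
  rewrite sqrrD !exprZn (sqrt_ext_sqr sP) expr1n scalerA -scalerAl mul1r -scalerMnl scalerA.
  by rewrite scalerDl [d%:~R * _]mulrC addrAC.
move=> Ec /eqP; rewrite -mulr_natr mulf_eq0 (negPf Q2_two_neq0) orbF mulf_eq0.
case/orP => /eqP z0; move: Ec; rewrite z0 expr0n /=.
  rewrite add0r => E.
  apply: (@square_class_reps_inj c d 1 v); rewrite ?radicand_rep ?oner_neq0 //.
  by rewrite expr1n mulr1.
by rewrite mulr0 addr0 => /(radicand_nonsquare cl).
Qed.

Lemma quadratic_ext_sqrt (K : fieldExtType Q2) : \dim {:K} = 2%N ->
  exists (c : int) (r : K), c \in quadratic_radicands /\ is_sqrt_ext c r.
Proof.
move=> dimK; have [x xF] : exists x : K, x \notin 1%VS.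
  apply: contrapT => /forallNP x1.
  have : ({:K} <= 1)%VS by apply/subvP => x _; apply/negPn/negP/x1.
  by move/dimvS; rewrite dimK dimv1.
(* completing the square in x^2 = p + q x *)
have [p [q x2]] := quadratic_coord dimK xF (x ^+ 2).
pose y := x - (q / 2%:R)%:A; pose d := p + (q / 2%:R) ^+ 2.
have yF : y \notin 1%VS.
  apply: contra xF => yF; rewrite -(subrK (q / 2%:R)%:A x) rpredD //.
  by rewrite rpredZ ?mem1v.
have y2 : y ^+ 2 = d%:A.
  have hE : (q / 2%:R)%:A *+ 2 = q%:A :> K.
    by rewrite -scaler_nat scalerA mulrC divfK // Q2_two_neq0.
  rewrite sqrrB -mulrnAr hE x2 mulr_algr addrK exprZn expr1n.
  by rewrite scalerDl.
have d0 : d != 0.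
  apply: contra yF => /eqP d0; move/eqP: y2; rewrite d0 scale0r sqrf_eq0.
  by move/eqP ->; rewrite mem0v.
have [e [s [eR s0 dE]]] := Q2_square_class d0.
pose r := s^-1 *: y.
have r2 : r ^+ 2 = e%:~R.
  rewrite exprZn y2 scalerA dE exprVn [_^-1 * _]mulrC mulfK ?expf_neq0 //.
  exact: (rmorph_int (in_alg K)).
have rF : r \notin 1%VS.
  by apply: contra yF => rF; rewrite -(scalerKV s0 y) rpredZ.
exists e, r; split; last by split=> //; apply: quadratic_generator.
have e1 : e != 1.
  apply: contra rF => /eqP e1; move/eqP: r2.
  by rewrite e1 sqrf_eq1 => /orP[] /eqP ->; rewrite ?rpredN mem1v.
have : all (fun e => (e == 1) || (e \in quadratic_radicands)) square_class_reps by [].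
by move/allP/(_ e eR); rewrite (negPf e1).
Qed.

(** The element a + r has norm a^2 - c, so it is a uniformizer. *)
Lemma sqrt_ext_ramified (K : splittingFieldType Q2) (r : K) (c a m : int) :
  c \in quadratic_radicands -> is_sqrt_ext c r ->
  a ^+ 2 - c = 2 * (1 + 2 * m) -> ~ unramified K.
Proof.
move=> cl rP E.
have rF := sqrt_ext_notin1 cl rP; have dimK := sqrt_ext_dim2 cl rP.
have r2 := sqrt_ext_sqr rP.
have galK := sqrt_quadratic_galois Q2_two_neq0 dimK rF r2.
have [sigma sP] := exists_nontrivial_aut galK.
have toK (z : int) : (tofrac (z%:~R : Z2))%:A = z%:~R :> K.
  by rewrite rmorph_int; apply: (rmorph_int (in_alg K)).
have toZ2 : (a ^+ 2 - c)%:~R = 2%:R * (1 + 2%:R * m%:~R) :> Z2.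
  by rewrite E !(intrM, intrD).
have xE : (a%:~R : Q2)%:A + 1 *: r = a%:~R + r :> K.
  by rewrite scale1r; congr (_ + _); apply: (rmorph_int (in_alg K)).
apply: (@ramified_of_uniformizer _ _ _ dimK rF r2 _ sP (a%:~R + r) m%:~R).
  apply: (@int_ring_quadratic _ _ (a *+ 2)%:~R (a ^+ 2 - c)%:~R).
  rewrite !toK sqrrD rP.1 !(intrD, rmorphB, rmorphXn, rmorphMn) /=; ring.
rewrite -toZ2 -xE (mul_aut_coord dimK rF r2 sP) expr1n mulr1 rmorph_int.
by rewrite rmorphB rmorphXn.
Qed.

Lemma sqrt_ext_norm (K : splittingFieldType Q2) (r : K) (c : int) (q : Q2) :
  c \in quadratic_radicands -> is_sqrt_ext c r -> q != 0 ->
  is_norm (q%:A : K) <-> norm_value c%:~R q.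
Proof.
move=> cl rP q0.
have rF := sqrt_ext_notin1 cl rP; have dimK := sqrt_ext_dim2 cl rP.
have r2 := sqrt_ext_sqr rP.
have [sigma sP] := exists_nontrivial_aut (sqrt_quadratic_galois Q2_two_neq0 dimK rF r2).
have normE := galNorm_quadratic Q2_two_neq0 dimK rF r2 sP.
have mulE := mul_aut_coord dimK rF r2 sP.
split=> [[x x0]|[u [v qE]]].
  have [u [v ->]] := quadratic_coord dimK rF x.
  by rewrite normE mulE => /(fmorph_inj (in_alg K)) <-; exists u, v.
exists (u%:A + v *: r); last by rewrite normE mulE qE.
apply/eqP => x0; have := mulE u v; rewrite x0 mul0r -qE => /esym/eqP.
by rewrite scaler_eq0 oner_eq0 orbF (negPf q0).
Qed.

(** * Quaternion algebras over the seven extensions *)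

Section QuaternionRepresentatives.
Variables (c : int) (K : splittingFieldType Q2) (r : K).
Hypotheses (cl : c \in quadratic_radicands) (rP : is_sqrt_ext c r).
Variables (sigma : gal_of {:K}) (R : set Q2).
Hypotheses (sigmaP : nontrivial_aut sigma) (RP : mod_sign_reps R).
Local Open Scope classical_set_scope.

Let rF := sqrt_ext_notin1 cl rP.
Let dimK := sqrt_ext_dim2 cl rP.
Let r2 := sqrt_ext_sqr rP.

Lemma represents_once_pair (n : nat) :
  (c, n%:Z) \in norm_nonnorm -> norm_value (c%:~R : Q2) (-1) ->
  represents_once sigma ([set r; n%:R * r] `|` [set 1 + s *: r | s in R]
                                           `|` [set n%:R + s *: r | s in R]).
Proof.
move=> /Q2_norm_index2 idx N1.
have alg_n : (n%:~R : Q2)%:A = n%:R :> K := rmorph_nat (in_alg K) n.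
have [n0 _ _] := idx.
apply: (represents_once_coord Q2_two_neq0 dimK rF r2 sigmaP idx RP.1 RP.2 _
  (sign_norm_reps_pair idx N1)).
  by move=> s [->|->]; first exact: oner_neq0.
move=> a; split.
  case=> [[[->|->]|[s Rs <-]]|[s Rs <-]].
  - by left; exists 1; [left | rewrite scale1r].
  - by left; exists n%:~R; [right | rewrite -alg_n mulr_algl].
  - by right; exists s => //; left.
  - by right; exists s => //; right; rewrite alg_n.
case=> [[s [->|->] ->]|[s Rs [->|->]]].
- by left; left; left; rewrite scale1r.
- by left; left; right; rewrite -alg_n mulr_algl.
- by left; right; exists s.
- by right; exists s; rewrite // alg_n.
Qed.

Lemma represents_once_single :
  (c, -1) \in norm_nonnorm -> represents_once sigma (reps_c r R).
Proof.
move=> /Q2_norm_index2; rewrite rmorphN1 => idx.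
apply: (represents_once_coord Q2_two_neq0 dimK rF r2 sigmaP idx RP.1 RP.2 _
  (sign_norm_reps_single idx)).
  by move=> s ->; exact: oner_neq0.
move=> a; split.
  case=> [[->|[s Rs <-]]|[s Rs <-]].
  - by left; exists 1; rewrite ?scale1r.
  - by right; exists s => //; left.
  - by right; exists s => //; right; rewrite scaleN1r.
case=> [[s -> ->]|[s Rs [->|->]]].
- by left; left; rewrite scale1r.
- by left; right; exists s.
- by right; exists s; rewrite // scaleN1r.
Qed.

End QuaternionRepresentatives.

Theorem theorem4p5 :
  (* the seven quadratic extensions of Q_2 *)
  [/\ forall c : int, c \in [:: -3; -6; 2; -1; -2; 3; 6] ->
        exists (K : splittingFieldType Q2) (r : K),
          quadratic_galois K /\ is_sqrt_ext c r,
      forall (c d : int) (K L : fieldExtType Q2) (r : K) (s : L),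
        c \in [:: -3; -6; 2; -1; -2; 3; 6] ->
        d \in [:: -3; -6; 2; -1; -2; 3; 6] ->
        is_sqrt_ext c r -> is_sqrt_ext d s -> ext_isomorphic K L -> c = d
    & forall K : fieldExtType Q2, \dim {:K} = 2%N ->
        exists (c : int) (r : K),
          c \in [:: -3; -6; 2; -1; -2; 3; 6] /\ is_sqrt_ext c r] /\
  (* nonassociative quaternion algebras with left nucleus K = Q_2(r) *)
  (forall (c : int) (K : splittingFieldType Q2) (r : K), is_sqrt_ext c r ->
     [/\ c = -3 ->
           [/\ quadratic_galois K, unramified K
             & forall (sigma : gal_of {:K}) (R : set Q2),
                 nontrivial_aut sigma -> mod_sign_reps R ->
                 represents_once sigma (reps_a r R)],
         c \in [:: 2; -6] ->
           [/\ quadratic_galois K, ~ unramified K, is_norm (-1 : K)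
             & forall (sigma : gal_of {:K}) (R : set Q2),
                 nontrivial_aut sigma -> mod_sign_reps R ->
                 represents_once sigma (reps_b r R)]
       & c \in [:: -1; -2; 3; 6] ->
           [/\ quadratic_galois K, ~ unramified K, ~ is_norm (-1 : K)
             & forall (sigma : gal_of {:K}) (R : set Q2),
                 nontrivial_aut sigma -> mod_sign_reps R ->
                 represents_once sigma (reps_c r R)]]).
Proof.
split.
  by split; [exact: sqrt_ext_exists | exact: sqrt_ext_iso_eq | exact: quadratic_ext_sqrt].
move=> c K r rP.
have galK (cl : c \in quadratic_radicands) : quadratic_galois K.
  have rF := sqrt_ext_notin1 cl rP.
  exact: sqrt_quadratic_galois Q2_two_neq0 (sqrt_ext_dim2 cl rP) rF (sqrt_ext_sqr rP).
have N1E : ((-1) : Q2)%:A = -1 :> K by rewrite scaleN1r.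
have N1_neq0 : (-1 : Q2) != 0 by rewrite oppr_eq0 oner_neq0.
split=> [c3|c2|c1].
- have cl : c \in quadratic_radicands by rewrite c3.
  split; first exact: galK.
    have [sigma sP] := exists_nontrivial_aut (galK cl).
    have rF := sqrt_ext_notin1 cl rP.
    apply: (unramified_sqrtN3 (sqrt_ext_dim2 cl rP) rF (sqrt_ext_sqr rP) sP).
    by rewrite c3 mulrNz.
  move=> sigma R sP RP; apply: (represents_once_pair cl rP sP RP (n := 2)).
    by rewrite c3.
  by apply: Q2_norm_values_N1; rewrite c3.
- have [cl cN] : c \in quadratic_radicands /\ (c, 3%:Z) \in norm_nonnorm.
    by move: c2; rewrite !inE => /orP[] /eqP ->.
  have N1 : norm_value (c%:~R : Q2) (-1).
    by apply: Q2_norm_values_N1; rewrite inE c2 orbT.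
  split; first exact: galK.
  + have [m mE] : exists m, 0 ^+ 2 - c = 2 * (1 + 2 * m).
      by move: c2; rewrite !inE => /orP[] /eqP ->; [exists (-1) | exists 1].
    exact: sqrt_ext_ramified cl rP mE.
  + by rewrite -N1E; apply/(sqrt_ext_norm cl rP).
  by move=> sigma R sP RP; apply: (represents_once_pair cl rP sP RP (n := 3)).
have [cl cN] : c \in quadratic_radicands /\ (c, -1) \in norm_nonnorm.
  by move: c1; rewrite !inE => /or4P[] /eqP ->.
split; first exact: galK.
- have [a [m mE]] : exists a m, a ^+ 2 - c = 2 * (1 + 2 * m).
    move: c1; rewrite !inE => /or4P[] /eqP ->.
    + by exists 1, 0.
    + by exists 0, 0.
    + by exists 1, (-1).
    + by exists 0, (-2).
  exact: sqrt_ext_ramified cl rP mE.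
- rewrite -N1E (sqrt_ext_norm cl rP) // => N1.
  by have [_ + _] := Q2_norm_index2 cN; rewrite rmorphN1.
by move=> sigma R sP RP; exact: (represents_once_single cl rP sP RP cN).
Qed.
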